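(* Let $n>1$ and $\frac1{n+1}\le\lambda<\frac n{n+1}$. Let $\mathbb B$ be the open Euclidean unit ball in $\mathbb C^n$, let $\boldsymbol B(z,w)=(1-\langle z,w\rangle)^{-(n+1)}$ and $\mathfrak B(z,w)=(1-\langle z,w\rangle)^{-1}$, and let $\mathcal H^{(\lambda)}$ be the Hilbert space of holomorphic functions on $\mathbb B$ with reproducing kernel $\boldsymbol B^\lambda(z,w)=(1-\langle z,w\rangle)^{-\lambda(n+1)}$. Then the curvature inequality $\mathcal K_{\boldsymbol B^\lambda}(w)\le\mathcal K_{\mathfrak B}(w)$ holds for all $w\in\mathbb B$, but the homomorphism of $\mathcal O(\mathbb B)$ induced by the commuting tuple of multiplications by the coordinate functions on $\mathcal H^{(\lambda)}$ is not contractive.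
   Context: For a kernel $K$ on $\mathbb B$, $\mathcal K_K(w)=-\big(\frac{\partial^2}{\partial w_i\partial\bar w_j}\log K(w,w)\big)_{i,j=1}^n$, and inequalities between such matrices are in the usual ordering of Hermitian matrices. $\mathcal O(\mathbb B)$ is the algebra of functions holomorphic in a neighborhood of $\overline{\mathbb B}$; the homomorphism induced by the multiplication tuple sends $f\in\mathcal O(\mathbb B)$ to the operator of multiplication by $f$ on $\mathcal H^{(\lambda)}$. It is contractive if the norm of this operator is at most $\sup_{\mathbb B}|f|$ for every $f\in\mathcal O(\mathbb B)$. *)

(* Defs.v *)
From HB Require Import structures.
From mathcomp Require Import all_boot all_order all_algebra.
From mathcomp Require Import complex.
From mathcomp Require Import all_classical all_reals all_analysis.

Set Implicit Arguments.
Unset Strict Implicit.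
Unset Printing Implicit Defensive.

Import Order.TTheory GRing.Theory Num.Theory numFieldNormedType.Exports.
Import ComplexField.Normc.

Local Open Scope classical_set_scope.
Local Open Scope ring_scope.
Local Open Scope sesquilinear_scope.

(* The usual topology and normed-module structure of [C] over itself. *)
HB.instance Definition _ (R : rcfType) := NormedModule.copy R[i] R[i]^o.

Section Ball.
Context {R : realType} {n : nat}.
Local Notation C := R[i].

(* [dotmx z w] is the inner product sum_i z_i * conj(w_i).  The sup norm that
   the library puts on ['rV[C]_n] is only used for its topology, which is the
   Euclidean one. *)
Definition uball : set 'rV[C]_n := [set z | dotmx z z < 1].

Definition closed_uball : set 'rV[C]_n := [set z | dotmx z z <= 1].

(* Scalars are complex, so Frechet differentiability is holomorphy. *)
Definition holomorphic_on (U : set 'rV[C]_n) (f : 'rV[C]_n -> C) : Prop :=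
  forall z, U z -> differentiable f z.

Definition holomorphic_near_closed_ball (f : 'rV[C]_n -> C) : Prop :=
  exists U, [/\ open U, closed_uball `<=` U & holomorphic_on U f].

End Ball.

Section Kernels.
Context {R : realType}.
Local Notation C := R[i].

(* The principal branch of [u ^ a] on the half-plane [Re u > 0], where the
   principal argument is [atan (Im u / Re u)].  For [z], [w] in the unit ball,
   [u = 1 - <z, w>] lies in this half-plane. *)
Definition cpow (u : C) (a : R) : C :=
  let t := a * atan (complex.Im u / complex.Re u) in
  (normc u `^ a)%:C%C * (cos t +i* sin t)%C.

Definition bergman_pow (n : nat) (lambda : R) (z w : 'rV[C]_n) : C :=
  cpow (1 - dotmx z w) (- (lambda * n.+1%:R)).

Definition drury_arveson (n : nat) (z w : 'rV[C]_n) : C := (1 - dotmx z w)^-1.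

End Kernels.

Section Curvature.
Context {R : realType} {n : nat}.
Local Notation C := R[i].
Implicit Types (g : 'rV[C]_n -> C) (v z : 'rV[C]_n).

Definition real_derive v g z : C :=
  (derive1 (fun t : R => complex.Re (g (z + t%:C%C *: v))) 0 +i*
   derive1 (fun t : R => complex.Im (g (z + t%:C%C *: v))) 0)%C.

(* Wirtinger derivatives d/dz_j = (d/dx_j - i d/dy_j) / 2 and
   d/dzbar_j = (d/dx_j + i d/dy_j) / 2. *)
Definition dz (j : 'I_n) g z : C :=
  (real_derive (delta_mx 0 j) g z
   - 'i%C * real_derive ('i%C *: delta_mx 0 j) g z) / 2.

Definition dzbar (j : 'I_n) g z : C :=
  (real_derive (delta_mx 0 j) g z
   + 'i%C * real_derive ('i%C *: delta_mx 0 j) g z) / 2.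

Definition curvature (K : 'rV[C]_n -> 'rV[C]_n -> C) (w : 'rV[C]_n) : 'M[C]_n :=
  - \matrix_(i, j)
      dz i (dzbar j (fun z => (ln (complex.Re (K z z)))%:C%C)) w.

(* In [C], [0 <= x] says that [x] is real and nonnegative. *)
Definition herm_le (A B : 'M[C]_n) : Prop :=
  [/\ A \is hermsymmx, B \is hermsymmx &
      forall v : 'rV[C]_n, 0 <= (v *m (B - A) *m v ^t*) 0 0].

End Curvature.

Section FunctionSpace.
Context {R : realType} {n : nat}.
Local Notation C := R[i].
Context (H : completeNormedModType C) (dot : {dot H for Num.conj}).

(* [ev] realizes the vectors of [H] as functions; only their values on the ball
   are relevant.  [dot] is linear in its first argument. *)
Record is_holomorphic_rkhs (K : 'rV[C]_n -> 'rV[C]_n -> C)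
    (ev : H -> 'rV[C]_n -> C) : Prop := {
  rkhs_norm : forall h, `|h| ^+ 2 = dot h h;
  rkhs_linear : forall (a : C) (h1 h2 : H) z, uball z ->
    ev (a *: h1 + h2) z = a * ev h1 z + ev h2 z;
  rkhs_inj : forall h1 h2 : H,
    (forall z, uball z -> ev h1 z = ev h2 z) -> h1 = h2;
  rkhs_holomorphic : forall h, holomorphic_on uball (ev h);
  rkhs_reproducing : forall w, uball w -> exists k : H,
    (forall z, uball z -> ev k z = K z w) /\ (forall h, ev h w = dot h k) }.

End FunctionSpace.

Section Contractivity.
Context {R : realType} {n : nat}.
Local Notation C := R[i].
Context (H : normedModType C) (ev : H -> 'rV[C]_n -> C).
Local Open Scope ereal_scope.

(* The norm in [H] of a function on the ball; it is [+oo] when the function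
   does not belong to [H]. *)
Definition fun_norm (g : 'rV[C]_n -> C) : \bar R :=
  ereal_inf [set (complex.Re `|h|%R)%:E | h in
    [set h : H | forall z, uball z -> ev h z = g z]].

Definition mult_norm (f : 'rV[C]_n -> C) : \bar R :=
  ereal_sup [set fun_norm (fun z => (f z * ev h z)%R) | h in
    [set h : H | (`|h| <= 1)%R]].

Definition sup_norm (f : 'rV[C]_n -> C) : \bar R :=
  ereal_sup [set (normc (f z))%:E | z in uball].

Definition mult_contractive : Prop :=
  forall f, holomorphic_near_closed_ball f -> mult_norm f <= sup_norm f.

End Contractivity.

(* Main.v *)
Require Import Defs.
From HB Require Import structures.
From mathcomp Require Import all_boot all_order all_algebra.
From mathcomp Require Import cyclic separable cyclotomic complex zify ring lra.
From mathcomp Require Import all_classical all_reals all_analysis.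
Import Order.TTheory GRing.Theory Num.Theory numFieldNormedType.Exports.
Import ComplexField.Normc.
Local Open Scope ring_scope.
Local Open Scope sesquilinear_scope.

Set Implicit Arguments.
Unset Strict Implicit.
Unset Printing Implicit Defensive.

(* Put [a := lambda * (n + 1)], so that [1 <= a < n].

   Curvature: on the diagonal [log K] is [- b * log (1 - |w|^2)], with [b = a]
   for the Bergman power and [b = 1] for Drury-Arveson, so the two curvatures
   are the multiples [- a] and [- 1] of one positive matrix.

   Contractivity: the monomials of degree [d] in [n] variables are indexed by
   the [T = 'C(d + n - 1, d)] sorted words [t]; let [M_t] be the number of
   rearrangements of [t] and [a_d] the coefficient of [u ^ d] in
   [(1 - u) ^ (- a)].  Every polynomial [p = sum_t +- sqrt M_t * z ^ t] has
   squared norm at least [T / a_d = prod_(j < d) (n + j) / (a + j)] in the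
   Hilbert space: pair [p] with a combination of kernel functions at the points
   [r * (roots of unity)] and let [r -> 0].  Since [n > a], this grows like a
   power of [d].  On the other hand, for a suitable choice of signs the supremum
   of [p] on the ball is [O(log d)]: at each point of the ball
   [sum_t M_t |z ^ t|^2 = |z| ^ (2 d) <= 1], so the signs give a subgaussian
   variable, and a net of polynomially many points controls the ball.
   Contractivity applied to the constant function [1], of norm [1], would bound
   the norm of [p] by its supremum. *)

(** * Real part, imaginary part and modulus *)

Lemma normc_Re (R : realType) (u : R[i]) : `|complex.Re u| <= normc u.
Proof. by have := normc_ge_Re u; rewrite lecR. Qed.

Lemma normc_Im (R : realType) (u : R[i]) : `|complex.Im u| <= normc u.
Proof.
by case: u => x y /=; rewrite -sqrtr_sqr ler_sqrt ?addr_ge0 ?sqr_ge0// lerDr sqr_ge0.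
Qed.

Lemma normc_le_ReIm (R : realType) (u : R[i]) : normc u <= `|complex.Re u| + `|complex.Im u|.
Proof.
case: u => a b /=; rewrite -(@ler_pXn2r _ 2) ?nnegrE ?sqrtr_ge0 ?addr_ge0//.
rewrite sqr_sqrtr ?addr_ge0 ?sqr_ge0// sqrrD !real_normK ?num_real//.
by rewrite addrAC lerDl mulrn_wge0// mulr_ge0.
Qed.

Lemma normcR (R : realType) (x : R) : normc (x%:C%C : R[i]) = `|x|.
Proof. by rewrite /= expr0n addr0 sqrtr_sqr. Qed.

Lemma ge0_ReE (R : realType) (z : R[i]) : 0 <= z -> z = (complex.Re z)%:C%C.
Proof. by case: z => x y; rewrite lecE /= => /andP[/eqP -> _]. Qed.

Lemma normr_normc (R : realType) (z : R[i]) : `|z| = (normc z)%:C%C.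
Proof. by []. Qed.

Lemma conj_real (R : realType) (x : R) : (x%:C%C : R[i])^* = x%:C%C.
Proof. by apply/eqP; rewrite eq_complex/= oppr0 !eqxx. Qed.

Lemma normc_ge0 (R : realType) (z : R[i]) : 0 <= normc z.
Proof. by case: z => x y; exact: sqrtr_ge0. Qed.

Lemma normc_sum (R : realType) (I : Type) (r : seq I) (P : pred I) (F : I -> R[i]) :
  normc (\sum_(i <- r | P i) F i) <= \sum_(i <- r | P i) normc (F i).
Proof.
elim/big_rec2: _ => [|i x z _ h]; first by rewrite normc0.
by apply: (le_trans (le_normcD _ _)); rewrite lerD2l.
Qed.

(** * Random signs *)

(** From [1 - x <= expR (- x)] follows [expR x <= 1 / (1 - x)], and [(1 - x) (1 + x + 2 x^2) = 1 +
    x^2 (1 - 2 x)] is at least [1] for [x <= 1/2]. *)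
Lemma expR_half_le (R : realType) (x : R) :
  `|x| <= 2^-1 -> expR x <= 1 + x + 2 * x ^+ 2.
Proof.
move=> hx; have /andP[h1 h2] : - 2^-1 <= x <= 2^-1 by rewrite -ler_norml.
have h := expR_ge1Dx (- x).
have e0 : 0 < expR x := expR_gt0 x.
have : expR x * (1 - x) <= 1.
  by rewrite -[leRHS](@divff _ (expR x)) ?gt_eqF// -expRN ler_pM2l.
have hp : 1 <= (1 - x) * (1 + x + 2 * x ^+ 2) by nra.
have hx1 : 0 < 1 - x by lra.
move=> /le_trans/(_ hp); rewrite mulrC ler_pM2l//.
Qed.

(** Independence of the signs turns the sum into a product, whose factors satisfy [expR (a i / 2) +
    expR (- a i / 2) <= 2 + a i ^ 2 <= 2 expR (a i ^ 2)]. The division by [2] brings the exponents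
    into the range of [expR_half_le]. *)
Lemma rademacher_real (R : realType) (I : finType) (a : I -> R) :
  \sum_i a i ^+ 2 <= 1 ->
  \sum_(eps : {ffun I -> bool}) expR ((\sum_i (-1) ^+ eps i * a i) / 2)
    <= #|{ffun I -> bool}|%:R * expR 1.
Proof.
move=> ha.
have -> : \sum_(eps : {ffun I -> bool}) expR ((\sum_i (-1) ^+ eps i * a i) / 2)
    = \prod_i \sum_(b : bool) expR ((-1) ^+ b * a i / 2).
  rewrite bigA_distr_bigA; apply: eq_bigr => eps _.
  by rewrite mulr_suml expR_sum.
apply: (@le_trans _ _ (\prod_i (2%:R * expR (a i ^+ 2)))).
  apply: ler_prod => i _; apply/andP; split.
    by apply: sumr_ge0 => b _; exact: expR_ge0.
  have ai : `|a i| <= 1.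
    rewrite -(@ler_pXn2r _ 2) ?nnegrE// expr1n real_normK ?num_real//.
    by apply: le_trans ha; rewrite (bigD1 i)//= lerDl sumr_ge0// => j _; exact: sqr_ge0.
  rewrite big_bool/= expr0 expr1 mul1r mulN1r.
  have h1 := @expR_half_le _ (a i / 2).
  have h2 := @expR_half_le _ (- a i / 2).
  have h0 := expR_ge1Dx (a i ^+ 2).
  have hh : `|a i / 2| <= 2^-1.
    by rewrite normrM [`|2^-1|]ger0_norm ?invr_ge0// ler_piMl ?invr_ge0.
  have := h1 hh; have := h2; rewrite mulNr normrN => /(_ hh).
  move: (expR _) (expR _) (expR _) h0 => u v w; nra.
rewrite big_split/= prodr_const -expR_sum card_ffun card_bool natrX.
by rewrite ler_wpM2l ?exprn_ge0// ler_expR.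
Qed.

(** The modulus is at most twice the larger of [|Re z|] and [|Im z|], and [expR (|x| / 2)] is one of
    [expR (x / 2)], [expR (- x / 2)]. This reduces complex sums to four real ones. *)
Lemma expR_normc_le (R : realType) (z : R[i]) :
  expR (normc z / 4) <= expR (complex.Re z / 2) + expR (- complex.Re z / 2)
    + expR (complex.Im z / 2) + expR (- complex.Im z / 2).
Proof.
case: z => a b /=.
have hab : Num.sqrt (a ^+ 2 + b ^+ 2) <= `|a| + `|b| := normc_le_ReIm (a +i* b)%C.
have hN (x : R) : expR (`|x| / 2) <= expR (x / 2) + expR (- x / 2).
  by have [_|_] := ger0P x; rewrite ?lerDl ?lerDr expR_ge0.
have [ab|/ltW ab] := leP `|a| `|b|.
  apply: (@le_trans _ _ (expR (`|b| / 2))).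
    by rewrite ler_expR; move: ab hab; lra.
  by apply: (le_trans (hN b)); rewrite -[leRHS]addrA lerDr addr_ge0 ?expR_ge0.
apply: (@le_trans _ _ (expR (`|a| / 2))).
  by rewrite ler_expR; move: ab hab; lra.
by apply: (le_trans (hN a)); rewrite -[leRHS]addrA lerDl addr_ge0 ?expR_ge0.
Qed.

Lemma rademacher_complex (R : realType) (I : finType) (c : I -> R[i]) :
  \sum_i (normc (c i)) ^+ 2 <= 1 ->
  \sum_(eps : {ffun I -> bool}) expR (normc (\sum_i (-1) ^+ eps i * c i) / 4)
    <= #|{ffun I -> bool}|%:R * (4 * expR 1).
Proof.
move=> hc.
have hsq (i : I) : normc (c i) ^+ 2 = complex.Re (c i) ^+ 2 + complex.Im (c i) ^+ 2.
  by case: (c i) => x y; rewrite /= sqr_sqrtr// addr_ge0 ?sqr_ge0.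
have hRe : \sum_i complex.Re (c i) ^+ 2 <= 1.
  by apply: le_trans hc; apply: ler_sum => i _; rewrite hsq lerDl sqr_ge0.
have hIm : \sum_i complex.Im (c i) ^+ 2 <= 1.
  by apply: le_trans hc; apply: ler_sum => i _; rewrite hsq lerDr sqr_ge0.
have sumRe (eps : {ffun I -> bool}) : complex.Re (\sum_i (-1) ^+ eps i * c i) =
    \sum_i (-1) ^+ eps i * complex.Re (c i).
  by rewrite raddf_sum; apply: eq_bigr => i _; case: (eps i) => /=;
    rewrite ?expr0 ?expr1 ?mul1r ?mulN1r// raddfN.
have sumIm (eps : {ffun I -> bool}) : complex.Im (\sum_i (-1) ^+ eps i * c i) =
    \sum_i (-1) ^+ eps i * complex.Im (c i).
  by rewrite raddf_sum; apply: eq_bigr => i _; case: (eps i) => /=;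
    rewrite ?expr0 ?expr1 ?mul1r ?mulN1r// raddfN.
have sumN (a : I -> R) (eps : {ffun I -> bool}) :
    - (\sum_i (-1) ^+ eps i * a i) = \sum_i (-1) ^+ eps i * - a i.
  by rewrite -sumrN; apply: eq_bigr => i _; rewrite mulrN.
have hN (a : I -> R) : \sum_i a i ^+ 2 <= 1 -> \sum_i (- a i) ^+ 2 <= 1.
  by move=> h; under eq_bigr do rewrite sqrrN.
have b1 := rademacher_real hRe.
have b2 := rademacher_real (hN _ hRe).
have b3 := rademacher_real hIm.
have b4 := rademacher_real (hN _ hIm).
apply: (@le_trans _ _ (\sum_(eps : {ffun I -> bool})
   (expR ((\sum_i (-1) ^+ eps i * complex.Re (c i)) / 2)
   + expR ((\sum_i (-1) ^+ eps i * - complex.Re (c i)) / 2)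
   + expR ((\sum_i (-1) ^+ eps i * complex.Im (c i)) / 2)
   + expR ((\sum_i (-1) ^+ eps i * - complex.Im (c i)) / 2)))).
  apply: ler_sum => eps _; apply: (le_trans (expR_normc_le _)).
  by rewrite sumRe sumIm !sumN.
rewrite !big_split/=.
apply: (le_trans (lerD (lerD (lerD b1 b2) b3) b4)).
lra.
Qed.

(** * Words and roots of unity *)

Section Words.
Context {C : comNzRingType} {k : nat}.
Implicit Types (x : 'I_k -> C) (u v : seq 'I_k).

(** Monomials are indexed by words, so that a power of a sum expands without multinomial
    coefficients; these reappear as [multiplicity] when words are grouped by their sorted
    rearrangement. *)
Definition word_prod x u : C := \prod_(i <- u) x i.

Lemma expr_sum_words d x : (\sum_i x i) ^+ d = \sum_(u : d.-tuple 'I_k) word_prod x u.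
Proof.
elim: d => [|d IH].
  rewrite expr0 (big_pred1 [tuple]) => [|u]; first by rewrite /word_prod big_nil.
  by apply/esym/eqP; exact: etrans (tuple0 u) (esym (tuple0 _)).
rewrite (reindex (fun p : 'I_k * d.-tuple 'I_k => [tuple of p.1 :: p.2])) /=; last first.
  exists (fun u : d.+1.-tuple 'I_k => (thead u, [tuple of behead u])).
    by move=> [i u] _; apply/eqP; rewrite xpair_eqE theadE eqxx -val_eqE eqxx.
  by move=> u _; rewrite [RHS]tuple_eta.
rewrite exprS IH big_distrlr/=.
by rewrite pair_big/=; apply: eq_bigr => p _; rewrite /word_prod big_cons.
Qed.

Lemma word_prod_count x u : word_prod x u = \prod_i x i ^+ count_mem i u.
Proof.
rewrite /word_prod; elim: u => [|j u IH]; first by rewrite big_nil big1.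
rewrite big_cons IH (bigD1 j)//= [RHS](bigD1 j)//= eqxx exprS mulrA.
by congr (_ * _); apply: eq_bigr => i /negPf ij; rewrite eq_sym ij.
Qed.

Lemma perm_word_prod x u v : perm_eq u v -> word_prod x u = word_prod x v.
Proof. by move=> uv; exact: perm_big. Qed.

End Words.

Section SortedWords.
Context {k d : nat}.
Notation word := (d.-tuple 'I_k).
Definition ord_le (i j : 'I_k) := (i <= j)%N.
Definition sorted_word (t : word) := sorted ord_le t.
Definition multiplicity (t : word) : nat := #|[set u : word | perm_eq u t]|.
Definition sort_word (u : word) : word := [tuple of sort ord_le u].

Lemma ord_le_total : total ord_le. Proof. by move=> i j; exact: leq_total. Qed.
Lemma ord_le_trans : transitive ord_le. Proof. by move=> i j l; exact: leq_trans. Qed.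
Lemma ord_le_anti : antisymmetric ord_le.
Proof. by move=> i j h; apply/val_inj/anti_leq. Qed.

Lemma sort_wordP (u : word) : sorted_word (sort_word u).
Proof. by rewrite /sorted_word /= sort_sorted//; exact: ord_le_total. Qed.

Lemma perm_sort_word (u : word) : perm_eq (sort_word u) u.
Proof. by rewrite /= perm_sort. Qed.

Lemma sorted_word_perm_eq (t u : word) : sorted_word t -> perm_eq u t = (sort_word u == t).
Proof.
move=> st; apply/idP/eqP => [ut|<-]; last by rewrite perm_sym perm_sort_word.
apply: val_inj; apply: (sorted_eq ord_le_trans ord_le_anti) => //.
  exact: sort_wordP.
by apply: perm_trans ut; exact: perm_sort_word.
Qed.

Lemma multiplicity_gt0 (t : word) : (0 < multiplicity t)%N.
Proof. by apply/card_gt0P; exists t; rewrite inE. Qed.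

Lemma sum_sorted_words (V : nmodType) (G : word -> V) :
  (forall u v : word, perm_eq u v -> G u = G v) ->
  \sum_(t | sorted_word t) G t *+ multiplicity t = \sum_u G u.
Proof.
move=> hG; rewrite [RHS](partition_big sort_word sorted_word) /=; last first.
  by move=> u _; exact: sort_wordP.
apply: eq_bigr => t st; rewrite -sumr_const; apply: eq_big => u.
  by rewrite inE sorted_word_perm_eq.
by rewrite inE perm_sym; exact: hG.
Qed.

Lemma card_sorted_words : (0 < k)%N -> #|[set t | sorted_word t]| = 'C(d + k.-1, d).
Proof.
rewrite /sorted_word /ord_le; case: k => // k' _; rewrite -card_sorted_tuples.
by apply: eq_card => t; rewrite !inE sorted_map.
Qed.
End SortedWords.

(** In characteristic zero [X^N - 1] is separable, so it has [N] distinct roots, and one of these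
    must be primitive. *)
Lemma prim_root_exists (C : numClosedFieldType) (N : nat) : (0 < N)%N ->
  exists z : C, N.-primitive_root z.
Proof.
move=> N0; have [r] := closed_field_poly_normal ('X^N - 1 : {poly C}).
rewrite (monicP _) ?monicXnsubC// scale1r => Er.
have rN : all N.-unity_root r by apply/allP => z; rewrite -root_prod_XsubC -Er.
have ur : uniq r.
  by rewrite -separable_prod_XsubC -Er separable_Xn_sub_1// pnatr_eq0 -lt0n.
have sr : (N <= size r)%N by rewrite -ltnS -(size_prod_XsubC r id) -Er size_XnsubC.
by have /hasP[z _ zP] := has_prim_root N0 rN ur sr; exists z.
Qed.

Section RootsOfUnity.
Context {C : numClosedFieldType} {k N : nat}.
Variable zeta : C.
Hypothesis zetaP : N.-primitive_root zeta.

Definition torus_point (e : {ffun 'I_k -> 'I_N}) (i : 'I_k) : C := zeta ^+ e i.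

Lemma norm_zeta : `|zeta| = 1.
Proof.
have N0 := prim_order_gt0 zetaP.
by apply/eqP; rewrite -(@pexpr_eq1 _ _ N)// -normrX (prim_expr_order zetaP) normr1.
Qed.

Lemma conj_zeta : zeta^* = zeta^-1.
Proof.
have z0 : zeta != 0 by rewrite -normr_eq0 norm_zeta oner_eq0.
by apply: (mulfI z0); rewrite -normCK norm_zeta expr1n divff.
Qed.

(** The sum factors over the coordinates into geometric sums of ratio [zeta ^ (count v - count u)].
    Each vanishes unless the two counts agree modulo [N], which is equality because both words are
    shorter than [N]. *)
Lemma torus_orthogonality (u v : seq 'I_k) : (size u < N)%N -> (size v < N)%N ->
  \sum_e (word_prod (torus_point e) u)^* * word_prod (torus_point e) v
    = (N ^ k * perm_eq u v)%:R.
Proof.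
move=> uN vN; have z0 : zeta != 0 by rewrite -normr_eq0 norm_zeta oner_eq0.
pose w i := zeta ^- count_mem i u * zeta ^+ count_mem i v.
have -> : \sum_e (word_prod (torus_point e) u)^* * word_prod (torus_point e) v =
    \sum_(e : {ffun 'I_k -> 'I_N}) \prod_i w i ^+ e i.
  apply: eq_bigr => e _; rewrite !word_prod_count rmorph_prod -big_split/=.
  apply: eq_bigr => i _; rewrite /torus_point /w !rmorphXn /= conj_zeta.
  by rewrite exprMn !exprVn -!exprM ![(e i * _)%N]mulnC.
rewrite -(bigA_distr_bigA (fun i (j : 'I_N) => w i ^+ j)).
have cnt i : (w i == 1) = (count_mem i u == count_mem i v).
  rewrite /w mulrC -[_ / _ == 1](inj_eq (mulIf (expf_neq0 (count_mem i u) z0))).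
  rewrite divfK ?expf_neq0// mul1r (eq_prim_root_expr zetaP).
  by rewrite !modn_small 1?eq_sym// ?(leq_ltn_trans (count_size _ _)).
have sumw i : \sum_(j < N) w i ^+ j = (N * (count_mem i u == count_mem i v))%:R.
  rewrite -cnt; have [->|w1] := eqVneq (w i) 1.
    by under eq_bigr do rewrite expr1n; rewrite sumr_const card_ord muln1.
  apply/eqP; rewrite muln0; have : w i ^+ N - 1 = 0.
    by rewrite /w exprMn exprVn -!exprM ![(_ * N)%N]mulnC !exprM
      (prim_expr_order zetaP) !expr1n invr1 mulr1 subrr.
  by rewrite subrX1 => /eqP; rewrite mulf_eq0 subr_eq0 (negPf w1).
under eq_bigr do rewrite sumw.
have [uv|uv] := boolP (perm_eq u v).
  rewrite muln1 natrX -[k in RHS]card_ord -prodr_const; apply: eq_bigr => i _.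
  by rewrite (permP uv) eqxx muln1.
rewrite muln0; apply/eqP; rewrite prodf_seq_eq0; apply/hasP.
move: uv; rewrite /perm_eq => /allPn[i _ /= /negPf h].
by exists i; rewrite ?mem_index_enum// h muln0 eqxx.
Qed.

End RootsOfUnity.

(** * Test coefficients on the discrete torus *)

Section TorusTest.
Context {C : numClosedFieldType} {k N d : nat}.
Variable zeta : C.
Hypothesis zetaP : N.-primitive_root zeta.
Hypothesis dN : (d < N)%N.
Variable y : d.-tuple 'I_k -> C.

Notation s e := (word_prod (torus_point (N := N) zeta e)).

(** The weights [1 / M_t] are those for which both the pairing with the polynomial and the Gram sum
    of degree [d] become multiples of [weighted_norm2]. *)
Definition test_coef (e : {ffun 'I_k -> 'I_N}) : C :=
  \sum_(t | sorted_word t) y t / (multiplicity t)%:R * s e t.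

(** The squared norm of [sum_t y t * z ^ t] in the Drury-Arveson space, where [z ^ t] has squared
    norm [1 / M_t]. *)
Definition weighted_norm2 : C :=
  \sum_(t | sorted_word t) `|y t| ^+ 2 / (multiplicity t)%:R.

Lemma sum_conj_test_coef (v : seq 'I_k) : (size v < N)%N ->
  \sum_(e : {ffun 'I_k -> 'I_N}) (test_coef e)^* * s e v =
  \sum_(t | sorted_word t) (y t / (multiplicity t)%:R)^* * (N ^ k * perm_eq t v)%:R.
Proof.
move=> vN.
transitivity (\sum_(e : {ffun 'I_k -> 'I_N}) \sum_(t | sorted_word t)
   (y t / (multiplicity t)%:R)^* * ((s e t)^* * s e v)).
  apply: eq_bigr => e _; rewrite /test_coef rmorph_sum mulr_suml.
  by apply: eq_bigr => t _; rewrite rmorphM mulrA.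
rewrite exchange_big/=; apply: eq_bigr => t _.
by rewrite -mulr_sumr (torus_orthogonality zetaP) ?size_tuple.
Qed.

Lemma sum_conj_test_coef_low m (v : m.-tuple 'I_k) : (m < d)%N ->
  \sum_(e : {ffun 'I_k -> 'I_N}) (test_coef e)^* * s e v = 0.
Proof.
move=> md; rewrite sum_conj_test_coef; last by rewrite size_tuple (ltn_trans md).
apply: big1 => t _; case: (boolP (perm_eq t v)); last by rewrite muln0 mulr0.
by move/perm_size; rewrite !size_tuple => dm; rewrite dm ltnn in md.
Qed.

Lemma sum_conj_test_coef_top (v : d.-tuple 'I_k) :
  \sum_(e : {ffun 'I_k -> 'I_N}) (test_coef e)^* * s e v =
  (N ^ k)%:R * (y (sort_word v) / (multiplicity (sort_word v))%:R)^*.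
Proof.
rewrite sum_conj_test_coef ?size_tuple//.
rewrite (bigD1 (sort_word v)) ?sort_wordP//= perm_sort_word muln1 mulrC big1 ?addr0//.
move=> t /andP[st tv]; rewrite perm_sym sorted_word_perm_eq// eq_sym (negPf tv).
by rewrite muln0 mulr0.
Qed.

Lemma sum_conj_test_coef_poly :
  \sum_(e : {ffun 'I_k -> 'I_N}) (test_coef e)^* * (\sum_(t | sorted_word t) y t * s e t) =
  (N ^ k)%:R * weighted_norm2.
Proof.
transitivity (\sum_(t | sorted_word t) y t * \sum_(e : {ffun 'I_k -> 'I_N}) (test_coef e)^* * s e t).
  under eq_bigr do rewrite mulr_sumr.
  rewrite exchange_big/=; apply: eq_bigr => t _; rewrite mulr_sumr.
  by apply: eq_bigr => e _; rewrite mulrCA.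
rewrite mulr_sumr; apply: eq_bigr => t st; rewrite sum_conj_test_coef_top.
have -> : sort_word t = t by apply/eqP; rewrite -sorted_word_perm_eq.
by rewrite mulrCA; congr (_ * _); rewrite fmorph_div /= rmorph_nat mulrA -normCK.
Qed.

(** The point of [e'] comes first, because the inner product of the kernel functions at [w] and [w']
    is [K w' w]. *)
Definition torus_dot (e e' : {ffun 'I_k -> 'I_N}) : C :=
  \sum_i torus_point zeta e' i * (torus_point zeta e i)^*.

(** The [m]-th power of the inner product expands over words [v] of length [m] into products of a
    monomial in [e'] and a conjugate monomial in [e], so the Hermitian form is a sum of squared
    moduli. *)
Lemma sum_torus_dot_expr m :
  \sum_e \sum_e' test_coef e * (test_coef e')^* * torus_dot e e' ^+ m =
  \sum_(v : m.-tuple 'I_k) `|\sum_(e : {ffun 'I_k -> 'I_N}) (test_coef e)^* * s e v| ^+ 2.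
Proof.
under [RHS]eq_bigr do rewrite normCK rmorph_sum big_distrlr/= exchange_big/=.
rewrite [RHS]exchange_big/=; apply: eq_bigr => e _.
rewrite [RHS]exchange_big/=; apply: eq_bigr => e' _.
rewrite /torus_dot expr_sum_words mulr_sumr; apply: eq_bigr => v _.
rewrite rmorphM /= conjCK [RHS]mulrACA [X in _ = X * _]mulrC; congr (_ * _).
rewrite /word_prod big_split/=; congr (_ * _).
by rewrite rmorph_prod.
Qed.

Lemma sum_torus_dot_low m : (m < d)%N ->
  \sum_e \sum_e' test_coef e * (test_coef e')^* * torus_dot e e' ^+ m = 0.
Proof.
move=> md; rewrite sum_torus_dot_expr big1// => v _.
by rewrite sum_conj_test_coef_low// normr0 expr0n.
Qed.

(** A word [v] with sorted form [t] contributes [N^(2k) |y t|^2 / M_t^2], and [M_t] words share this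
    sorted form. *)
Lemma sum_torus_dot_top :
  \sum_e \sum_e' test_coef e * (test_coef e')^* * torus_dot e e' ^+ d =
  (N ^ k)%:R ^+ 2 * weighted_norm2.
Proof.
rewrite sum_torus_dot_expr.
under eq_bigr do rewrite sum_conj_test_coef_top normrM exprMn normr_nat.
rewrite -mulr_sumr; congr (_ * _).
rewrite -(sum_sorted_words (G := fun v => `|(y (sort_word v) / (multiplicity (sort_word v))%:R)^*| ^+ 2)).
  apply: eq_bigr => t st.
  have -> : sort_word t = t by apply/eqP; rewrite -sorted_word_perm_eq.
  have m0 : (multiplicity t)%:R != 0 :> C by rewrite pnatr_eq0 -lt0n multiplicity_gt0.
  rewrite norm_conjC normf_div normr_nat -[LHS]mulr_natr.
  by move: (`|y t|) ((multiplicity t)%:R) m0 => a b b0; field.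
move=> u v uv; suff -> : sort_word u = sort_word v by [].
apply/eqP; rewrite -sorted_word_perm_eq ?sort_wordP//.
by apply: (perm_trans uv); rewrite perm_sym perm_sort_word.
Qed.

End TorusTest.

(** * Taylor expansion of the kernel *)

Section CpowTaylor.
Context {R : realType}.
Implicit Types (u c : R[i]) (a b r : R).

(** Writing [|u| ^ a] as [expR (a / 2 * ln (|u|^2))] removes the square root and leaves an
    expression that is easy to differentiate. *)
Lemma cpow_polar u a : 0 < complex.Re u ->
  let q := complex.Re u ^+ 2 + complex.Im u ^+ 2 in
  let t := a * atan (complex.Im u / complex.Re u) in
  cpow u a = (expR (a / 2 * ln q) * cos t +i* (expR (a / 2 * ln q) * sin t))%C.
Proof.
case: u => x y /= x0; set q := x ^+ 2 + y ^+ 2.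
have q0 : 0 < q by rewrite ltr_wpDr ?sqr_ge0// exprn_gt0.
have s0 : 0 < Num.sqrt q by rewrite sqrtr_gt0.
have -> : ln q = 2 * ln (Num.sqrt q).
  by rewrite -[in LHS](sqr_sqrtr (ltW q0)) lnXn// mulr_natl.
rewrite /cpow /= -/q /powR gt_eqF//.
rewrite mulrA divfK//.
by apply/eqP; rewrite eq_complex/= !mul0r subr0 addr0 !eqxx.
Qed.

Lemma cpow_sub1 u a : 0 < complex.Re u -> cpow u (a - 1) = cpow u a / u.
Proof.
case: u => x y /= x0; rewrite /cpow /=; set q := x ^+ 2 + y ^+ 2.
set t := atan _.
have q0 : 0 < q by rewrite ltr_wpDr ?sqr_ge0// exprn_gt0.
have s0 : 0 < Num.sqrt q by rewrite sqrtr_gt0.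
have sE : Num.sqrt (1 + (y / x) ^+ 2) = Num.sqrt q / x.
  have -> : 1 + (y / x) ^+ 2 = q / x ^+ 2.
    by rewrite expr_div_n /q mulrDl divff// sqrf_eq0 gt_eqF.
  by rewrite sqrtrM ?(ltW q0)// sqrtrV ?sqr_ge0// sqrtr_sqr gtr0_norm.
have ct : cos t = x / Num.sqrt q by rewrite cos_atan sE invf_div.
have st : sin t = y / Num.sqrt q.
  have ctn : cos t != 0 by rewrite ct mulf_neq0 ?invr_eq0 ?gt_eqF.
  rewrite -[LHS](divfK ctn) -/(tan t) atanK ct mulrA divfK// gt_eqF//.
rewrite powRD; last by rewrite (gt_eqF s0) ?implybT.
rewrite powR_inv1 ?(ltW s0)// mulrBl mul1r cosB sinB ct st.
have sq : Num.sqrt q ^+ 2 = q by rewrite sqr_sqrtr// ltW.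
have sn : Num.sqrt q != 0 by rewrite gt_eqF.
move: (_ `^ _) (cos _) (sin _) => p ca sa.
move: (Num.sqrt q) sq sn => s sq sn.
by apply/eqP; rewrite eq_complex/= -/q -sq; apply/andP; split; apply/eqP; field.
Qed.

Let z1 c r : R[i] := 1 - r%:C%C * c.

Lemma Re_z1 c r : complex.Re (z1 c r) = 1 - r * complex.Re c.
Proof. by case: c => x y; rewrite /z1 /= mul0r subr0. Qed.

Lemma Im_z1 c r : complex.Im (z1 c r) = - (r * complex.Im c).
Proof. by case: c => x y; rewrite /z1 /= mul0r addr0 sub0r. Qed.

(** This is the derivative [b c (1 - r c)^(- b - 1)] of [(1 - r c)^(- b)], taken along the real
    variable [r] on the polar form; [cpow_sub1] absorbs the factor [1 / (1 - r c)] into the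
    exponent. *)
Lemma is_derive_cpow c b r : 0 < complex.Re (z1 c r) ->
  let d := b%:C%C * c * cpow (z1 c r) (- (b + 1)) in
  is_derive r 1 (fun s => complex.Re (cpow (z1 c s) (- b))) (complex.Re d) /\
  is_derive r 1 (fun s => complex.Im (cpow (z1 c s) (- b))) (complex.Im d).
Proof.
move=> zr0 d.
pose x s := 1 - s * complex.Re c; pose y s := - (s * complex.Im c).
pose q s := x s ^+ 2 + y s ^+ 2.
have x0 : 0 < x r by rewrite /x -Re_z1.
have xn : x r != 0 by rewrite gt_eqF.
have q0 : 0 < q r by rewrite ltr_wpDr ?sqr_ge0// exprn_gt0.
have dx : is_derive r 1 x (- complex.Re c).
  by apply: is_derive_eq; rewrite /GRing.scale/=; ring.
have dy : is_derive r 1 y (- complex.Im c).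
  by apply: is_derive_eq; rewrite /GRing.scale/=; ring.
have dq : is_derive r 1 q (2 * (x r * - complex.Re c + y r * - complex.Im c)).
  by apply: is_derive_eq; rewrite /GRing.scale/=; ring.
have dlq : is_derive r 1 (fun s => ln (q s)) _ :=
  @is_derive1_comp _ (@ln R) q r _ _ (is_derive1_ln q0) dq.
pose E s := expR (- b / 2 * ln (q s)).
pose t s := - b * atan (y s / x s).
have dE : is_derive r 1 E
    (E r * (- b / 2 * ((q r)^-1 * (2 * (x r * - complex.Re c + y r * - complex.Im c))))).
  exact: (@is_derive1_comp _ expR (fun s => - b / 2 * ln (q s)) r _ _
    (is_derive_expR _) (is_deriveZ (- b / 2) dlq)).
have dt : is_derive r 1 t
    (- b * ((x r * - complex.Im c + y r * complex.Re c) / q r)).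
  have dxi : is_derive r 1 (fun s => (x s)^-1) (- (x r) ^- 2 *: - complex.Re c).
    exact: (is_deriveV xn dx).
  have h : is_derive r 1 (fun s => atan (y s / x s)) _ :=
    @is_derive1_comp _ atan (fun s => y s / x s) r _ _ (is_derive1_atan _)
      (is_deriveM dy dxi).
  apply: (is_derive_eq (is_deriveZ (- b) h)).
  rewrite /GRing.scale/= /q; field.
  by rewrite xn /= gt_eqF.
have dcos : is_derive r 1 (fun s => cos (t s)) _ :=
  @is_derive1_comp _ cos t r _ _ (is_derive_cos _) dt.
have dsin : is_derive r 1 (fun s => sin (t s)) _ :=
  @is_derive1_comp _ sin t r _ _ (is_derive_sin _) dt.
(* The polar form needs a positive real part. This persists near [r], which suffices for
   derivatives. *)
have near0 : \forall s \near r, 0 < x s.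
  have : {for r, continuous x} by apply/differentiable_continuous/derivable1_diffP; exact: ex_derive.
  by move/cvgr_gt; apply.
have cpE : \forall s \near r, cpow (z1 c s) (- b) = (E s * cos (t s) +i* (E s * sin (t s)))%C.
  near=> s; rewrite cpow_polar; last by rewrite Re_z1; near: s.
  by rewrite Re_z1 Im_z1.
have dval : d = (b%:C%C * c / z1 c r) * (E r * cos (t r) +i* (E r * sin (t r)))%C.
  rewrite /d opprD cpow_sub1// -(nbhs_singleton cpE) mulrA; ring.
have xE : z1 c r = (x r +i* y r)%C by apply/eqP; rewrite eq_complex/= Re_z1 Im_z1 !eqxx.
have cE : c = (complex.Re c +i* complex.Im c)%C by case: (c).
have qn : x r ^+ 2 + y r ^+ 2 != 0 by rewrite gt_eqF.
split.
  have hh : is_derive r 1 (fun s => E s * cos (t s)) (complex.Re d).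
    apply: (is_derive_eq (is_deriveM dE dcos)).
    rewrite dval xE /GRing.scale [in b%:C%C * c]cE /=.
    move: (E r) (cos _) (sin _) => e0 co si; by rewrite /q; field.
  apply: near_eq_is_derive hh.
  by near=> s; rewrite (near cpE s).
have hh : is_derive r 1 (fun s => E s * sin (t s)) (complex.Im d).
  apply: (is_derive_eq (is_deriveM dE dsin)).
  rewrite dval xE /GRing.scale [in b%:C%C * c]cE /=.
  move: (E r) (cos _) (sin _) => e0 co si; by rewrite /q; field.
apply: near_eq_is_derive hh.
by near=> s; rewrite (near cpE s).
Unshelve. all: by end_near. Qed.

(** The coefficient of [u ^ m] in [(1 - u) ^ (- b)]. *)
Definition pow_coef b (m : nat) : R := (\prod_(i < m) (b + i%:R)) / m`!%:R.

Definition pow_taylor b (N : nat) c r : R[i] :=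
  \sum_(m < N) (pow_coef b m * r ^+ m)%:C%C * c ^+ m.

Lemma pow_coefS b m : m.+1%:R * pow_coef b m.+1 = b * pow_coef (b + 1) m.
Proof.
rewrite /pow_coef big_ord_recl addr0 factS natrM invfM.
have -> : \prod_(i < m) (b + (bump 0 i)%:R) = \prod_(i < m) (b + 1 + i%:R).
  by apply: eq_bigr => i _; rewrite /bump leq0n add1n -addrA -natr1 [1 + _]addrC.
have : m.+1%:R != 0 :> R by rewrite pnatr_eq0.
by move: (m`!%:R^-1) (\prod_(_ < _) _) (m.+1%:R) => F P k k0; field.
Qed.

Lemma mean_value_pow (f df : R -> R) (C r : R) (N : nat) : 0 <= r -> f 0 = 0 ->
  (forall s, 0 <= s <= r -> is_derive s 1 f (df s)) ->
  (forall s, 0 <= s <= r -> `|df s| <= C * s ^+ N) ->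
  `|f r| <= C * r ^+ N.+1.
Proof.
move=> r0 f0 dfE dfC.
have C0 : 0 <= C * r ^+ N by apply: le_trans (dfC r _); rewrite ?normr_ge0// r0 lexx.
move: r0; rewrite le_eqVlt => /predU1P[<-|r0].
  by rewrite f0 normr0 expr0n mulr0.
have [||s sr] := @MVT R f df 0 r r0.
- by move=> s; rewrite in_itv/= => /andP[/ltW ? /ltW ?]; apply: dfE; apply/andP.
- apply: derivable_within_continuous => s; rewrite in_itv/= => h.
  by have := dfE s h; move=> hd; exact: ex_derive.
move: sr; rewrite in_itv/= => /andP[s0 sr]; rewrite f0 !subr0 => ->.
rewrite normrM (gtr0_norm r0) exprSr mulrA ler_pM2r//.
apply: (le_trans (dfC s _)); first by rewrite !ltW.
(* A negative [C] is impossible: at [s > 0] the hypothesis would bound [|df s|] by a negative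
   number. *)
have [C0'|C0'] := leP 0 C.
  by rewrite ler_wpM2l// lerXn2r// ?nnegrE ltW.
by have := le_trans (normr_ge0 (df s)) (dfC s (introT andP (conj (ltW s0) (ltW sr))));
  rewrite leNgt nmulr_rlt0 ?exprn_gt0//.
Qed.

Lemma is_derive_pow_taylor b N c r :
  let d := b%:C%C * c * pow_taylor (b + 1) N c r in
  is_derive r 1 (fun s => complex.Re (pow_taylor b N.+1 c s)) (complex.Re d) /\
  is_derive r 1 (fun s => complex.Im (pow_taylor b N.+1 c s)) (complex.Im d).
Proof.
move=> d.
have dE : d = \sum_(m < N.+1) (pow_coef b m * (m%:R * r ^+ m.-1))%:C%C * c ^+ m.
  rewrite big_ord_recl mul0r mulr0 rmorph0 mul0r add0r /d /pow_taylor mulr_sumr.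
  apply: eq_bigr => i _; rewrite lift0 /= exprS.
  have -> : pow_coef b i.+1 * (i.+1%:R * r ^+ i) = b * pow_coef (b + 1) i * r ^+ i.
    by rewrite -pow_coefS; ring.
  by rewrite !rmorphM /=; ring.
have ReC (x : R) (z : R[i]) : complex.Re (x%:C%C * z) = x * complex.Re z.
  by case: z => u v; rewrite /= mul0r subr0.
have ImC (x : R) (z : R[i]) : complex.Im (x%:C%C * z) = x * complex.Im z.
  by case: z => u v; rewrite /= mul0r addr0.
have aux (p : nat -> R) : is_derive r 1 (fun s => \sum_(m < N.+1) pow_coef b m * s ^+ m * p m)
    (\sum_(m < N.+1) pow_coef b m * (m%:R * r ^+ m.-1) * p m).
  have -> : (fun s => \sum_(m < N.+1) pow_coef b m * s ^+ m * p m) =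
     \sum_(m < N.+1) (fun s => pow_coef b m * s ^+ m * p m).
    by apply/funext => s; rewrite fct_sumE.
  apply: is_derive_sum => i.
  have hX : is_derive r 1 (fun s : R => s ^+ i) (i%:R * r ^+ i.-1).
    apply: DeriveDef; first exact: exprn_derivable.
    by rewrite exp_derive /GRing.scale/= mulr1.
  have -> : (fun s => pow_coef b i * s ^+ i * p i) = (fun s => (pow_coef b i * p i) *: s ^+ i).
    by apply/funext => s; rewrite /GRing.scale/=; ring.
  apply: (is_derive_eq (is_deriveZ _ hX)).
  by rewrite /GRing.scale/= ; ring.
split.
  rewrite dE raddf_sum/=; under eq_bigr do rewrite ReC.
  under eq_fun do (rewrite raddf_sum/=; under eq_bigr do rewrite ReC).
  exact: (aux (fun m => complex.Re (c ^+ m))).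
rewrite dE raddf_sum/=; under eq_bigr do rewrite ImC.
under eq_fun do (rewrite raddf_sum/=; under eq_bigr do rewrite ImC).
exact: (aux (fun m => complex.Im (c ^+ m))).
Qed.

Lemma normc_cpow u a : 0 < complex.Re u -> normc (cpow u a) = normc u `^ a.
Proof.
move=> u0; rewrite /cpow normcM normcR ger0_norm ?powR_ge0//.
by rewrite /= cos2Dsin2 sqrtr1 mulr1.
Qed.

Lemma cpow1 a : cpow (1 : R[i]) a = 1.
Proof.
rewrite /cpow /= mul0r atan0 mulr0 cos0 sin0 expr1n expr0n addr0 sqrtr1 powR1.
by rewrite mul1r.
Qed.

(** Induction on [N]: the remainder of order [N + 1] for [b] vanishes at [0], and its derivative is
    [b c] times the remainder of order [N] for [b + 1], so the mean value theorem gains one power of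
    [r]. The condition [r * B <= 1/2] keeps the real part of [1 - r c] above [1/2], which makes the
    constant uniform in [c]. *)
Lemma cpow_taylor (N : nat) b (B : R) : 0 <= b -> 0 <= B -> exists2 C : R, 0 <= C &
  forall c r, normc c <= B -> 0 <= r -> r * B <= 2^-1 ->
    normc (cpow (1 - r%:C%C * c) (- b) - pow_taylor b N c r) <= C * r ^+ N.
Proof.
move=> b0 B0; elim: N b b0 => [|N IH] b b0.
  exists ((2^-1) `^ (- b)); first exact: powR_ge0.
  move=> c r cB r0 rB.
  have h : 2^-1 <= complex.Re (1 - r%:C%C * c).
    rewrite (Re_z1 c r); have h1 := ler_norm (complex.Re c).
    have h2 := le_trans (normc_Re c) cB; nra.
  have h0 : 0 < complex.Re (1 - r%:C%C * c) by apply: lt_le_trans h; rewrite invr_gt0.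
  rewrite /pow_taylor big_ord0 subr0 normc_cpow// expr0 mulr1.
  rewrite !powRN lef_pV2 ?posrE ?powR_gt0 ?invr_gt0//; last first.
    by apply: lt_le_trans (normc_Re _); apply: lt_le_trans (ler_norm _).
  apply: ge0_ler_powR => //; rewrite ?nnegrE ?invr_ge0//.
    by case: (1 - _) => ? ? /=; exact: sqrtr_ge0.
  by apply: le_trans (normc_Re _); apply: le_trans (ler_norm _).
have [C C0 HC] := IH (b + 1) (addr_ge0 b0 ler01).
(* One summand bounds the real part of the remainder, the other its imaginary part. *)
exists (b * B * C + b * B * C); first by rewrite addr_ge0// !mulr_ge0.
move=> c r cB r0 rB.
have Re0 s : 0 <= s <= r -> 0 < complex.Re (z1 c s).
  move=> /andP[s0 sr]; rewrite (Re_z1 c s); have h1 := ler_norm (complex.Re c).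
  have h2 := le_trans (normc_Re c) cB; nra.
pose D s := cpow (z1 c s) (- b) - pow_taylor b N.+1 c s.
pose dD s := b%:C%C * c * (cpow (z1 c s) (- (b + 1)) - pow_taylor (b + 1) N c s).
have D0 : D 0 = 0.
  rewrite /D /z1 /pow_taylor big_ord_recl big1 => [|i _]; last first.
    by rewrite lift0 expr0n/= mulr0 mul0r.
  rewrite mul0r subr0 cpow1 /pow_coef big_ord0 fact0 divr1 !expr0 !mulr1 addr0.
  by rewrite subrr.
have dDB s : 0 <= s <= r -> normc (dD s) <= b * B * C * s ^+ N.
  move=> /andP[s0 sr]; rewrite /dD !normcM normcR ger0_norm// -[leRHS]mulrA.
  have nc0 (u : R[i]) : 0 <= normc u by case: u => ? ? /=; exact: sqrtr_ge0.
  apply: ler_pM => //; rewrite ?mulr_ge0//; first by rewrite ler_wpM2l.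
  by apply: HC => //; nra.
have dRe s : 0 <= s <= r -> is_derive s 1 (fun s => complex.Re (D s)) (complex.Re (dD s)).
  move=> h; have [h1 _] := is_derive_cpow b (Re0 s h).
  have [h2 _] := is_derive_pow_taylor b N c s.
  under eq_fun do rewrite /D raddfB.
  by apply: (is_derive_eq (is_deriveB h1 h2)); rewrite -raddfB/= -mulrBr.
have dIm s : 0 <= s <= r -> is_derive s 1 (fun s => complex.Im (D s)) (complex.Im (dD s)).
  move=> h; have [_ h1] := is_derive_cpow b (Re0 s h).
  have [_ h2] := is_derive_pow_taylor b N c s.
  under eq_fun do rewrite /D raddfB.
  by apply: (is_derive_eq (is_deriveB h1 h2)); rewrite -raddfB/= -mulrBr.
apply: (le_trans (normc_le_ReIm _)); rewrite mulrDl; apply: lerD.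
  apply: (@mean_value_pow (fun s => complex.Re (D s)) _ _ _ _ r0 _ dRe).
    by rewrite D0.
  by move=> s h; apply: (le_trans (normc_Re _)); exact: dDB.
apply: (@mean_value_pow (fun s => complex.Im (D s)) _ _ _ _ r0 _ dIm).
  by rewrite D0.
by move=> s h; apply: (le_trans (normc_Im _)); exact: dDB.
Qed.

End CpowTaylor.

(** * Norms of homogeneous polynomials *)

Lemma word_prodZ (C : comNzRingType) k (r : C) (x : 'I_k -> C) u :
  word_prod (fun i => r * x i) u = r ^+ size u * word_prod x u.
Proof.
by rewrite /word_prod big_split/= big_const_seq count_predT iter_mulr_1.
Qed.

Lemma dotmx_sum (C : numClosedFieldType) n (z w : 'rV[C]_n) :
  dotmx z w = \sum_i z 0 i * (w 0 i)^*.
Proof. by rewrite dotmxE !mxE; apply: eq_bigr => i _; rewrite !mxE. Qed.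

Lemma real_cauchy_schwarz (R : realType) (H : lmodType R[i])
    (dot : {dot H for Num.conj}) (h g : H) (X : R) :
  dot h g = X%:C%C ->
  X ^+ 2 <= complex.Re (dot h h) * complex.Re (dot g g).
Proof.
move=> hg; set A := complex.Re (dot h h); set B := complex.Re (dot g g).
have hA : dot h h = A%:C%C by apply: ge0_ReE; exact: dnorm_ge0.
have hB : dot g g = B%:C%C by apply: ge0_ReE; exact: dnorm_ge0.
have A0 : 0 <= A by rewrite -lecR -hA dnorm_ge0.
have [B0|B0] := ltP 0 B; last first.
  have g0 : g = 0.
    by apply/eqP; rewrite -(dnorm_eq0 dot) hB eq_le lecR B0 -hB dnorm_ge0.
  move: hg; rewrite g0 linear0r => -[<-].
  by rewrite expr0n mulr_ge0// /B g0 linear0r.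
have : 0 <= dot (h - (X / B)%:C%C *: g) (h - (X / B)%:C%C *: g) by exact: dnorm_ge0.
rewrite dnormB dnormZ linearZr_LR /= hA hB hg normr_normc normcR.
rewrite !conj_real -!rmorphXn/= real_normK ?num_real//.
rewrite lecE/= ?(mul0r, mulr0, subr0, addr0) => /andP[_ le0].
have : 0 <= B * (A + (X / B) ^+ 2 * B - (X / B * X + X / B * X)).
  by rewrite mulr_ge0 ?(ltW B0).
have -> : B * (A + (X / B) ^+ 2 * B - (X / B * X + X / B * X)) = A * B - X ^+ 2.
  by field; rewrite gt_eqF.
by rewrite subr_ge0.
Qed.

Lemma le_of_small_perturbation (R : realFieldType) (X Y Z eps : R) : 0 < eps ->
  (forall rho, 0 < rho <= eps -> X <= Y + rho * Z) -> X <= Y.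
Proof.
move=> eps0 h; rewrite leNgt; apply/negP => XY.
have Z1 : 0 < `|Z| + 1 by rewrite ltr_pwDr.
pose rho := Num.min eps ((X - Y) / 2 / (`|Z| + 1)).
have r1 : rho <= eps by rewrite ge_min lexx.
have r2 : rho <= (X - Y) / 2 / (`|Z| + 1) by rewrite ge_min lexx orbT.
have r0 : 0 < rho by rewrite lt_min eps0 !divr_gt0// subr_gt0.
have := h rho; rewrite r0 r1 => /(_ isT).
move: r2; rewrite ler_pdivlMr// => r2.
have : rho * Z <= rho * (`|Z| + 1).
  by rewrite ler_pM2l// (le_trans (ler_norm _))// lerDl.
lra.
Qed.

Section NormLowerBound.
Context {R : realType} {n d : nat} (a : R).
Notation C := R[i].
Context (H : completeNormedModType C) (dot : {dot H for Num.conj})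
  (ev : H -> 'rV[C]_n -> C).
Hypothesis a0 : 0 <= a.
Hypothesis rkhs :
  is_holomorphic_rkhs dot (fun z w => cpow (1 - dotmx z w) (- a)) ev.
Variables (y : d.-tuple 'I_n -> C) (h : H).
Hypothesis evh : forall z, uball z ->
  ev h z = \sum_(t | sorted_word t) y t * word_prod (z 0) t.

(** Let [g] combine, with weights [test_coef], the kernel functions at [sqrt rho] times the torus
    points. Orthogonality makes [dot h g] equal to [rho^(d/2) M s], and removes the Taylor terms of
    degree below [d] from [dot g g], leaving [a_d rho^d M^2 s + O(rho^(d+1))]. Cauchy-Schwarz,
    division by [rho^d] and [rho -> 0] give the bound. *)
Lemma rkhs_norm_lower_bound :
  complex.Re (weighted_norm2 y) <= pow_coef a d * complex.Re (dot h h).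
Proof.
(* Order [d + 1] is the least that separates words of length up to [d]. *)
have [zeta zetaP] := prim_root_exists C (ltn0Sn d).
set s := complex.Re (weighted_norm2 y).
have S0 : 0 <= weighted_norm2 y.
  by apply: sumr_ge0 => t _; rewrite divr_ge0// exprn_ge0.
have SE : weighted_norm2 y = s%:C%C by exact: ge0_ReE.
have s0 : 0 <= s by rewrite -lecR -SE.
set A := complex.Re (dot h h).
have A0 : 0 <= A.
  have : 0 <= dot h h by exact: dnorm_ge0.
  by rewrite (ge0_ReE (dnorm_ge0 dot h)) lecR.
have aD0 : 0 <= pow_coef a d.
  by rewrite divr_ge0// prodr_ge0// => i _; rewrite addr_ge0.
pose M : R := (d.+1 ^ n)%:R.
have M0 : 0 < M by rewrite ltr0n expn_gt0.
pose c := test_coef (N := d.+1) zeta y.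
have [K K0 taylor] := cpow_taylor d.+1 a0 (ler0n R n).
pose K' := \sum_e \sum_e' normc (c e) * normc (c e') * K.
(* This is the desired inequality multiplied by [s * M ^ 2], the form in which Cauchy-Schwarz
   delivers it. *)
suff main : s ^+ 2 * M ^+ 2 <= A * (pow_coef a d * M ^+ 2 * s).
  have [->|sn] := eqVneq s 0; first by rewrite mulr_ge0.
  have sp : 0 < s by rewrite lt_neqAle eq_sym sn.
  have Mp : 0 < s * M ^+ 2 by rewrite mulr_gt0// exprn_gt0.
  by rewrite -(ler_pM2r Mp); move: main; congr (_ <= _); ring.
(* For [rho <= eps] one has [rho * n <= 1/2], which puts the points in the ball and meets the
   condition of [cpow_taylor] with [B = n]. *)
pose eps : R := (4 * n.+1%:R)^-1.
have eps0 : 0 < eps by rewrite invr_gt0 mulr_gt0// ltr0n.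
apply: (@le_of_small_perturbation _ _ _ (A * K') eps eps0) => rho /andP[rho0 rho_eps].
have rhon : rho * n%:R <= 2^-1.
  have : rho * n.+1%:R <= eps * n.+1%:R by rewrite ler_pM2r// ltr0n.
  have -> : eps * n.+1%:R = 4^-1 by rewrite /eps invfM mulfVK// pnatr_eq0.
  rewrite -natr1; lra.
pose r := Num.sqrt rho.
have r0 : 0 < r by rewrite sqrtr_gt0.
have r2 : r ^+ 2 = rho by rewrite sqr_sqrtr// ltW.
pose w (e : {ffun 'I_n -> 'I_d.+1}) : 'rV[C]_n := \row_i (r%:C%C * torus_point zeta e i).
have w_dot e e' : dotmx (w e') (w e) = rho%:C%C * torus_dot zeta e e'.
  rewrite dotmx_sum /torus_dot mulr_sumr; apply: eq_bigr => i _.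
  by rewrite !mxE rmorphM /= conj_real mulrACA -rmorphM -expr2 r2.
have norm_tp (e : {ffun 'I_n -> 'I_d.+1}) i : `|torus_point zeta e i| = 1.
  by rewrite normrX (norm_zeta zetaP) expr1n.
have norm_td (e e' : {ffun 'I_n -> 'I_d.+1}) : normc (torus_dot zeta e e') <= n%:R.
  rewrite -lecR -normr_normc rmorph_nat.
  apply: (le_trans (ler_norm_sum _ _ _)).
  under eq_bigr do rewrite normrM norm_conjC !norm_tp mulr1.
  by rewrite sumr_const card_ord.
have w_ball e : uball (w e).
  rewrite /uball /= w_dot.
  have -> : torus_dot zeta e e = n%:R.
    rewrite /torus_dot; under eq_bigr do rewrite -normCK norm_tp expr1n.
    by rewrite sumr_const card_ord.
  rewrite -(rmorph_nat (real_complex R)) -rmorphM ltcR.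
  by apply: le_lt_trans rhon _; lra.
have [k kP] := boolp.choice (fun e => rkhs_reproducing rkhs (w_ball e)).
pose g := \sum_e c e *: k e.
have hg : dot h g = (r ^+ d * (M * s))%:C%C.
  rewrite /g linear_sumr /=.
  transitivity (\sum_e (c e)^* * (r%:C%C ^+ d * \sum_(t | sorted_word t) y t * word_prod (torus_point zeta e) t)).
    apply: eq_bigr => e _; rewrite linearZr_LR /= -(kP e).2 evh//; congr (_ * _).
    rewrite mulr_sumr; apply: eq_bigr => t _; rewrite mulrCA; congr (_ * _).
    have -> : r%:C%C ^+ d = r%:C%C ^+ size t by rewrite size_tuple.
    rewrite -word_prodZ.
    by apply: eq_bigr => i _; rewrite mxE.
  under eq_bigr do rewrite mulrCA.
  rewrite -mulr_sumr (sum_conj_test_coef_poly zetaP)//.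
  by rewrite SE !rmorphM rmorphXn rmorph_nat.
have gg : dot g g = \sum_e \sum_e' c e * (c e')^* * cpow (1 - rho%:C%C * torus_dot zeta e e') (- a).
  rewrite {1}/g linear_sumlz; apply: eq_bigr => e _.
  rewrite linearZl_LR /= /g linear_sumr /= mulr_sumr; apply: eq_bigr => e' _.
  rewrite linearZr_LR /= -mulrA; congr (_ * (_ * _)).
  by rewrite -(kP e').2 (kP e).1// w_dot.
have mainE : \sum_e \sum_e' c e * (c e')^* * pow_taylor a d.+1 (torus_dot zeta e e') rho
    = (pow_coef a d * rho ^+ d * (M ^+ 2 * s))%:C%C.
  transitivity (\sum_(m < d.+1) (pow_coef a m * rho ^+ m)%:C%C *
     \sum_e \sum_e' c e * (c e')^* * torus_dot zeta e e' ^+ m).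
    under eq_bigr do under eq_bigr do rewrite mulr_sumr.
    under eq_bigr do rewrite exchange_big/=.
    rewrite exchange_big/=; apply: eq_bigr => m _.
    rewrite mulr_sumr; apply: eq_bigr => e _; rewrite mulr_sumr.
    by apply: eq_bigr => e' _; rewrite mulrCA.
  rewrite big_ord_recr/= big1 ?add0r => [|m _]; last first.
    by rewrite (sum_torus_dot_low zetaP) ?mulr0.
  rewrite (sum_torus_dot_top zetaP)// SE [RHS]rmorphM; congr (_ * _).
  by rewrite rmorphM rmorphXn rmorph_nat.
have Bd : complex.Re (dot g g) <= pow_coef a d * rho ^+ d * (M ^+ 2 * s) + K' * rho ^+ d.+1.
  rewrite -lerBlDl.
  have -> : complex.Re (dot g g) - pow_coef a d * rho ^+ d * (M ^+ 2 * s) =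
     complex.Re (dot g g - (pow_coef a d * rho ^+ d * (M ^+ 2 * s))%:C%C).
    by rewrite raddfB.
  apply: le_trans (le_trans (ler_norm _) (normc_Re _)) _.
  rewrite -mainE gg -sumrB /K' mulr_suml.
  apply: (le_trans (normc_sum _ _ _)); apply: ler_sum => e _.
  rewrite -sumrB mulr_suml; apply: (le_trans (normc_sum _ _ _)); apply: ler_sum => e' _.
  rewrite -mulrBr normcM -mulrA; apply: ler_pM; rewrite ?normc_ge0//.
    rewrite normcM; apply: ler_pM; rewrite ?normc_ge0//.
    by rewrite -lecR -!normr_normc norm_conjC.
  by apply: taylor => //; exact: ltW.
have := real_cauchy_schwarz hg; rewrite -/A.
move=> /le_trans/(_ (ler_wpM2l A0 Bd)).
have -> : (r ^+ d * (M * s)) ^+ 2 = rho ^+ d * (s ^+ 2 * M ^+ 2).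
  by rewrite 2!exprMn -exprM mulnC exprM r2 [M ^+ 2 * _]mulrC.
have -> : A * (pow_coef a d * rho ^+ d * (M ^+ 2 * s) + K' * rho ^+ d.+1) =
   rho ^+ d * (A * (pow_coef a d * M ^+ 2 * s) + rho * (A * K')).
  by rewrite [rho ^+ d.+1]exprS; ring.
by rewrite ler_pM2l// exprn_gt0.
Qed.

End NormLowerBound.

(** * Norms of polynomials under contractivity *)

Section Contractive.
Context {R : realType} {n : nat}.
Notation C := R[i].

Lemma holomorphic_word_poly (I : Type) (s : seq I) (P : pred I)
    (y : I -> C) (w : I -> seq 'I_n) :
  holomorphic_near_closed_ball
    (fun z : 'rV[C]_n => \sum_(t <- s | P t) y t * word_prod (z 0) (w t)).
Proof.
exists setT; split => //; first exact: openT.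
move=> z _; elim: s => [|t s IH].
  under eq_fun do rewrite big_nil; exact: differentiable_cst.
under eq_fun do rewrite big_cons.
have dw (u : seq 'I_n) : differentiable (fun z : 'rV[C]_n => word_prod (z 0) u) z.
  elim: u => [|i u IHu].
    under eq_fun do rewrite /word_prod big_nil; exact: differentiable_cst.
  under eq_fun do rewrite /word_prod big_cons.
  by apply: differentiableM => //; exact: differentiable_coord.
case: (P t); last exact: IH.
have dt : differentiable (fun z : 'rV[C]_n => y t * word_prod (z 0) (w t)) z :=
  differentiableM (differentiable_cst (y t) z) (dw (w t)).
exact: (differentiableD dt IH).
Qed.

(** The kernel function at [0] is the constant [1] and has norm [1], so multiplying it by [p] bounds
    the norm of [p] itself by the supremum of [p]. *)
Lemma contractive_bound (H : completeNormedModType C) (dot : {dot H for Num.conj})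
    (ev : H -> 'rV[C]_n -> C) (K : 'rV[C]_n -> 'rV[C]_n -> C) :
  is_holomorphic_rkhs dot K ev -> (forall z, uball z -> K z 0 = 1) ->
  mult_contractive ev ->
  forall (p : 'rV[C]_n -> C) (B : R), holomorphic_near_closed_ball p ->
    (forall z, uball z -> normc (p z) <= B) ->
  exists2 h : H, (forall z, uball z -> ev h z = p z) &
    complex.Re (dot h h) <= B ^+ 2.
Proof.
move=> rkhs K1 contr p B hp pB.
have ball0 : uball (0 : 'rV[C]_n) by rewrite /uball /= linear0l.
have [k0 [ek0 hk0]] := rkhs_reproducing rkhs ball0.
have nk0 : `|k0| = 1.
  have /eqP : `|k0| ^+ 2 = 1 by rewrite (rkhs_norm rkhs) -hk0 ek0// K1.
  by rewrite sqrp_eq1// => /eqP.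
have le1 : (fun_norm ev p <= B%:E)%E.
  apply: le_trans (_ : mult_norm ev p <= _)%E.
    apply: ereal_sup_ubound; exists k0; first by rewrite /= nk0.
    congr ereal_inf; apply/seteqP; split => _ [h hh <-]; exists h => // z zb /=;
      by move: (hh z zb); rewrite /= ek0// K1// mulr1.
  apply: (le_trans (contr p hp)); apply: ge_ereal_sup => _ [z zb <-].
  by rewrite lee_fin; exact: pB.
(* [fun_norm] is an infimum and yields representatives of [p] only up to [eps]; by [rkhs_inj] they
   are all the same vector. *)
have near_h (eps : R) : 0 < eps -> exists2 h : H, (forall z, uball z -> ev h z = p z) &
    complex.Re `|h| < B + eps.
  move=> e0; have : (fun_norm ev p < (B + eps)%:E)%E.
    by apply: (le_lt_trans le1); rewrite lte_fin ltrDl.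
  by move=> /ereal_inf_lt[_ [h hh <-]]; rewrite lte_fin => hB; exists h.
have [h eh _] := near_h 1 ltr01; exists h => //.
have hB : complex.Re `|h| <= B.
  apply/ler_addgt0Pr => eps e0; have [h' eh' /ltW] := near_h eps e0.
  suff -> : h' = h by [].
  by apply: (rkhs_inj rkhs) => z zb; rewrite eh ?eh'.
have h0 : 0 <= complex.Re `|h| by have := normr_ge0 h; rewrite lecE => /andP[].
have -> : dot h h = (complex.Re `|h| ^+ 2)%:C%C.
  by rewrite -(rkhs_norm rkhs) rmorphXn /= -(ge0_ReE (normr_ge0 h)).
by rewrite /= lerXn2r// nnegrE (le_trans h0).
Qed.

End Contractive.

(** * Flat polynomials *)

(** Rounding goes towards zero, so that a rounded point of the ball stays in the closed ball. The
    indices [0 .. 2m], shifted by [m], encode the numerators [-m .. m]. *)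
Lemma grid_point (R : realType) (m : nat) (x : R) : (0 < m)%N -> `|x| <= 1 ->
  exists j : 'I_(m.*2.+1), let q := (j%:R - m%:R) / m%:R in
    `|q| <= `|x| /\ `|x - q| <= m%:R^-1.
Proof.
move=> m0 x1; have m0' : 0 < m%:R :> R by rewrite ltr0n.
have xm0 : 0 <= `|x| * m%:R by rewrite mulr_ge0.
pose k := Num.truncn (`|x| * m%:R).
have /andP[k1 k2] : k%:R <= `|x| * m%:R < k.+1%:R by exact: truncn_itv.
have km : (k <= m)%N.
  by rewrite -(ler_nat R) (le_trans k1)// ler_piMl// ltW.
have q1 : k%:R / m%:R <= `|x| by rewrite ler_pdivrMr.
have q2 : `|x| - k%:R / m%:R <= m%:R^-1.
  have -> : `|x| - k%:R / m%:R = (`|x| * m%:R - k%:R) / m%:R.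
    by field; rewrite gt_eqF.
  rewrite ler_pdivrMr// mulVf ?gt_eqF//.
  by move: k2; rewrite -natr1; lra.
have q0 : 0 <= k%:R / m%:R :> R by rewrite divr_ge0// ltW.
have [xp|xn] := leP 0 x.
  have jm : (m + k < m.*2.+1)%N by rewrite ltnS -addnn leq_add2l.
  exists (Ordinal jm) => /=; rewrite natrD addrAC subrr add0r.
  rewrite (ger0_norm xp) in q1 q2 *; rewrite !ger0_norm//; first by rewrite subr_ge0.
have jm : (m - k < m.*2.+1)%N by rewrite ltnS -addnn (leq_trans (leq_subr _ _))// leq_addr.
exists (Ordinal jm) => /=; rewrite natrB// addrAC subrr add0r mulNr opprK normrN.
rewrite (ltr0_norm xn) in q1 q2 *; rewrite (ger0_norm q0); split => //.
by rewrite ler0_norm; lra.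
Qed.

Lemma dotmx_self (R : realType) n (z : 'rV[R[i]]_n) :
  dotmx z z = (\sum_i normc (z 0 i) ^+ 2)%:C%C.
Proof.
rewrite dotmx_sum rmorph_sum; apply: eq_bigr => i _.
by rewrite -normCK normr_normc rmorphXn.
Qed.

Lemma normc_coord_le1 (R : realType) n (z : 'rV[R[i]]_n) i :
  \sum_i normc (z 0 i) ^+ 2 <= 1 -> normc (z 0 i) <= 1.
Proof.
move=> z1; rewrite -(@expr_le1 _ 2)// ?normc_ge0//; apply: le_trans z1.
by rewrite (bigD1 i)//= lerDl sumr_ge0// => j _; exact: sqr_ge0.
Qed.

Section Net.
Context {R : realType} {n m : nat}.
Notation C := R[i].

(** The boolean selects the real part ([false]) or the imaginary part ([true]) of a coordinate. *)
Definition net_point (f : {ffun 'I_n * bool -> 'I_(m.*2.+1)}) : 'rV[C]_n :=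
  let q b i := ((f (i, b))%:R - m%:R) / m%:R in
  \row_i (q false i +i* q true i)%C.

Lemma net_approx (z : 'rV[C]_n) : (0 < m)%N ->
  \sum_i normc (z 0 i) ^+ 2 <= 1 ->
  exists f, \sum_i normc (net_point f 0 i) ^+ 2 <= 1 /\
    forall i, normc (z 0 i - net_point f 0 i) <= 2 / m%:R.
Proof.
move=> m0 z1.
have hc i (b : bool) : exists j : 'I_(m.*2.+1), let q := (j%:R - m%:R) / m%:R in
    let x := if b then complex.Im (z 0 i) else complex.Re (z 0 i) in
    `|q| <= `|x| /\ `|x - q| <= m%:R^-1.
  apply: grid_point => //; apply: le_trans (normc_coord_le1 i z1).
  by case: b; [exact: normc_Im|exact: normc_Re].
have [f hf] := boolp.choice (fun ib : 'I_n * bool => hc ib.1 ib.2).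
exists (finfun f); split.
  apply: le_trans z1; apply: ler_sum => i _; rewrite mxE !ffunE.
  have /= [h1 _] := hf (i, false); have /= [h2 _] := hf (i, true).
  move: h1 h2; case: (z 0 i) => a b /= h1 h2.
  rewrite !sqr_sqrtr ?addr_ge0 ?sqr_ge0//.
  by apply: lerD; rewrite -(real_normK (num_real _)) -[leRHS](real_normK (num_real _)) lerXn2r// nnegrE.
move=> i; rewrite mxE !ffunE; apply: (le_trans (normc_le_ReIm _)).
have /= [_ h1] := hf (i, false); have /= [_ h2] := hf (i, true).
move: h1 h2; case: (z 0 i) => a b /= h1 h2.
by apply: (le_trans (lerD h1 h2)); rewrite -mulr2n mulr_natl.
Qed.

End Net.

Lemma normc_exprB (R : realType) (a b : R[i]) d :
  normc a <= 1 -> normc b <= 1 -> normc (a ^+ d - b ^+ d) <= d%:R * normc (a - b).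
Proof.
move=> a1 b1; rewrite subrXX normcM mulrC ler_wpM2r ?normc_ge0//.
apply: (le_trans (normc_sum _ _ _)).
rewrite -[leRHS]mulr1 -[d in leRHS]card_ord -sum1_card natr_sum mulr_suml.
apply: ler_sum => i _; rewrite mul1r normcM.
have X1 (x : R[i]) k : normc x <= 1 -> normc (x ^+ k) <= 1.
  move=> x1; elim: k => [|k IH]; first by rewrite expr0 normc1.
  by rewrite exprS normcM mulr_ile1 ?normc_ge0.
by rewrite mulr_ile1 ?normc_ge0 ?X1.
Qed.

Section Lipschitz.
Context {R : realType} {n d : nat}.
Notation C := R[i].
Implicit Types z w : 'rV[C]_n.

Lemma sum_words_sqr z : \sum_(u : d.-tuple 'I_n) normc (word_prod (z 0) u) ^+ 2 =
  (\sum_i normc (z 0 i) ^+ 2) ^+ d.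
Proof.
rewrite expr_sum_words; apply: eq_bigr => u _; rewrite /word_prod.
elim: (tval u) => [|i s IH]; first by rewrite !big_nil normc1 expr1n.
by rewrite !big_cons normcM exprMn IH.
Qed.

Lemma normc_dotmx_le z w (eta : R) : (forall i, normc (z 0 i) <= 1) ->
  (forall i, normc (w 0 i) <= eta) -> normc (dotmx z w) <= n%:R * eta.
Proof.
move=> z1 w1; rewrite dotmx_sum; apply: (le_trans (normc_sum _ _ _)).
rewrite -[n in leRHS]card_ord -sum1_card natr_sum mulr_suml.
apply: ler_sum => i _; rewrite normcM; apply: ler_pM; rewrite ?normc_ge0//.
by have <- : normc (w 0 i) = normc (w 0 i)^*
  by apply: complexI; rewrite -!normr_normc norm_conjC.
Qed.

(** The word monomials of [z] are the entries of its [d]-th tensor power, and tensor powers have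
    inner products [<z, w> ^ d]. The squared distance is thus a sum of two differences of [d]-th
    powers of numbers in the unit disc, and [normc_exprB] applies to each. *)
Lemma sum_words_sqrB z w (eta : R) :
  \sum_i normc (z 0 i) ^+ 2 <= 1 -> \sum_i normc (w 0 i) ^+ 2 <= 1 ->
  (forall i, normc (z 0 i - w 0 i) <= eta) ->
  \sum_(u : d.-tuple 'I_n) normc (word_prod (z 0) u - word_prod (w 0) u) ^+ 2
    <= 2 * d%:R * n%:R * eta.
Proof.
move=> z1 w1 zw.
(* Abstracting [dotmx] keeps unification from unfolding it when rewriting. *)
have [D DE] : exists D : 'rV[C]_n -> 'rV[C]_n -> C, forall a b, D a b = dotmx a b.
  by exists (fun a b => dotmx a b).
have DX (a b : 'rV[C]_n) : D a b ^+ d =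
   \sum_(u : d.-tuple 'I_n) word_prod (a 0) u * (word_prod (b 0) u)^*.
  rewrite DE dotmx_sum expr_sum_words; apply: eq_bigr => u _.
  by rewrite /word_prod big_split/= rmorph_prod.
have sumE : (\sum_(u : d.-tuple 'I_n) normc (word_prod (z 0) u - word_prod (w 0) u) ^+ 2)%:C%C
  = (D z z ^+ d - D z w ^+ d) + (D w w ^+ d - D w z ^+ d).
  rewrite !DX rmorph_sum -!sumrB -big_split; apply: eq_bigr => u _.
  by rewrite rmorphXn /= -normr_normc normCK rmorphB /=; ring.
have cs (a b : 'rV[C]_n) : \sum_i normc (a 0 i) ^+ 2 <= 1 ->
    \sum_i normc (b 0 i) ^+ 2 <= 1 -> normc (D a b) <= 1.
  move=> a1 b1; rewrite DE dotmx_sum; apply: (le_trans (normc_sum _ _ _)).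
  apply: (@le_trans _ _ (\sum_i (normc (a 0 i) ^+ 2 / 2 + normc (b 0 i) ^+ 2 / 2))).
    apply: ler_sum => i _; rewrite normcM.
    have -> : normc (b 0 i)^* = normc (b 0 i)
      by apply: complexI; rewrite -!normr_normc norm_conjC.
    have := sqr_ge0 (normc (a 0 i) - normc (b 0 i)); rewrite sqrrB; lra.
  by rewrite big_split/= -!mulr_suml; lra.
have eta_dot (a b : 'rV[C]_n) : \sum_i normc (a 0 i) ^+ 2 <= 1 ->
    \sum_i normc (b 0 i) ^+ 2 <= 1 -> (forall i, normc (a 0 i - b 0 i) <= eta) ->
    normc (D a a ^+ d - D a b ^+ d) <= d%:R * (n%:R * eta).
  move=> a1 b1 ab; apply: (le_trans (normc_exprB _ (cs _ _ a1 a1) (cs _ _ a1 b1))).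
  rewrite ler_wpM2l// !DE -linearBr; apply: normc_dotmx_le => i.
    exact: normc_coord_le1.
  by rewrite !mxE.
have wz i : normc (w 0 i - z 0 i) <= eta by rewrite -normcN opprB.
have hz := eta_dot _ _ z1 w1 zw; have hw := eta_dot _ _ w1 z1 wz.
rewrite -[leLHS]ger0_norm; last by apply: sumr_ge0 => u _; exact: sqr_ge0.
rewrite -normcR sumE; apply: (le_trans (le_normcD _ _)).
have -> : 2 * d%:R * n%:R * eta = d%:R * (n%:R * eta) + d%:R * (n%:R * eta) by ring.
exact: lerD.
Qed.

End Lipschitz.

Section FlatPolynomials.
Context {R : realType} {n d : nat}.
Notation C := R[i].
Notation word := (d.-tuple 'I_n).

(** With modulus [sqrt M_t], every sorted word contributes exactly [1] to [weighted_norm2], whatever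
    the signs. *)
Definition flat_coef (eps : {ffun word -> bool}) (t : word) : C :=
  (-1) ^+ eps t * (Num.sqrt (multiplicity t)%:R)%:C%C.

Definition flat_poly eps (z : 'rV[C]_n) : C :=
  \sum_(t | sorted_word t) flat_coef eps t * word_prod (z 0) t.

Lemma normc_sign (b : bool) : normc ((-1) ^+ b : C) = 1.
Proof. by case: b; rewrite ?expr1 ?expr0 ?normcN normc1. Qed.

Lemma normc_flat_coef eps t : normc (flat_coef eps t) ^+ 2 = (multiplicity t)%:R.
Proof.
by rewrite normcM normc_sign mul1r normcR ger0_norm ?sqrtr_ge0// sqr_sqrtr.
Qed.

Lemma weighted_norm2_flat eps :
  complex.Re (weighted_norm2 (flat_coef eps)) = #|[set t : word | sorted_word t]|%:R.
Proof.
rewrite /weighted_norm2 (eq_bigr (fun=> 1)) => [|t _].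
  by rewrite sumr_const -cardsE -(rmorph_nat (real_complex R)).
have m0 : (multiplicity t)%:R != 0 :> C by rewrite pnatr_eq0 -lt0n multiplicity_gt0.
by rewrite normr_normc -rmorphXn /= normc_flat_coef rmorph_nat divff.
Qed.

Lemma sum_expR_flat_poly (z : 'rV[C]_n) : \sum_i normc (z 0 i) ^+ 2 <= 1 ->
  \sum_eps expR (normc (flat_poly eps z) / 4)
    <= #|{ffun word -> bool}|%:R * (4 * expR 1).
Proof.
move=> z1.
(* The signs are indexed by all words, so the coefficients are extended by [0] to the unsorted ones.
   Grouping words gives [sum_t M_t |z ^ t|^2 = |z| ^ (2 d) <= 1]. *)
pose c (t : word) : C := if sorted_word t then
  (Num.sqrt (multiplicity t)%:R)%:C%C * word_prod (z 0) t else 0.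
have c1 : \sum_t normc (c t) ^+ 2 <= 1.
  have -> : \sum_t normc (c t) ^+ 2 = \sum_(u : word) normc (word_prod (z 0) u) ^+ 2.
    rewrite -(sum_sorted_words (G := fun u : word => normc (word_prod (z 0) u) ^+ 2)); last first.
      by move=> u v /perm_word_prod ->.
    rewrite [RHS]big_mkcond; apply: eq_bigr => t _; rewrite /c.
    case: ifP => _; last by rewrite normc0 expr0n.
    rewrite normcM exprMn normcR ger0_norm ?sqrtr_ge0// sqr_sqrtr//.
    by rewrite mulr_natl.
  by rewrite sum_words_sqr exprn_ile1// sumr_ge0// => i _; exact: sqr_ge0.
apply: le_trans (rademacher_complex c1).
rewrite le_eqVlt; apply/orP; left; apply/eqP; apply: eq_bigr => eps _.
congr (expR (normc _ / 4)); rewrite /flat_poly big_mkcond/=.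
apply: eq_bigr => t _; rewrite /c /flat_coef.
by case: ifP => _; rewrite ?mulr0// mulrA.
Qed.

(** Each of the [T] terms changes by at most [1 / T]: the square of its change is [M_t] equal
    summands of the sum in [sum_words_sqrB]. *)
Lemma flat_poly_lipschitz eps (z w : 'rV[C]_n) (eta : R) (T : nat) :
  T = #|[set t : word | sorted_word t]| ->
  (0 < T)%N ->
  \sum_i normc (z 0 i) ^+ 2 <= 1 -> \sum_i normc (w 0 i) ^+ 2 <= 1 ->
  (forall i, normc (z 0 i - w 0 i) <= eta) ->
  2 * d%:R * n%:R * eta <= T%:R ^- 2 ->
  normc (flat_poly eps z) <= normc (flat_poly eps w) + 1.
Proof.
move=> TE T0 z1 w1 zw eta_small; rewrite -lerBlDl.
have T0' : 0 < T%:R :> R by rewrite ltr0n.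
apply: (@le_trans _ _ (normc (flat_poly eps z - flat_poly eps w))).
  by rewrite lerBlDr -[X in normc X <= _](subrK (flat_poly eps w)) le_normcD.
rewrite /flat_poly -sumrB; apply: (le_trans (normc_sum _ _ _)).
have -> : 1 = \sum_(t : word | sorted_word t) (T%:R^-1 : R).
  by rewrite sumr_const -cardsE -TE -[RHS]mulr_natr mulVf// gt_eqF.
apply: ler_sum => t st; rewrite -mulrBr.
rewrite -(@ler_pXn2r _ 2) ?nnegrE ?normc_ge0 ?invr_ge0 ?(ltW T0')//.
rewrite normcM exprMn normc_flat_coef exprVn.
apply: le_trans eta_small; apply: le_trans (sum_words_sqrB z1 w1 zw).
pose G (u : word) := normc (word_prod (z 0) u - word_prod (w 0) u) ^+ 2.
rewrite -(sum_sorted_words (G := G)); last first.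
  by move=> u v uv; rewrite /G !(perm_word_prod _ uv).
rewrite (bigD1 t)//= mulr_natl lerDl; apply: sumr_ge0 => u _.
by rewrite mulrn_wge0// sqr_ge0.
Qed.

(** Averaging over the signs finds one choice that is good at all net points together, and the
    Lipschitz bound extends it to the ball at the cost of the [- 1]. The value of [m] makes
    [2 d n (2 / m) = T^(-2)]; the factor [(2 m + 1)^(2 n)] bounds the size of the net. *)
Lemma exists_flat_poly (T m : nat) :
  T = #|[set t : word | sorted_word t]| ->
  (0 < T)%N -> (0 < d)%N -> (0 < n)%N -> m = (4 * d * n * T ^ 2)%N ->
  exists eps, forall z : 'rV[C]_n, uball z ->
    expR ((normc (flat_poly eps z) - 1) / 4) <= (m.*2.+1 ^ (n * 2))%:R * (4 * expR 1).
Proof.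
move=> TE T0 d0 n0 mE.
have m0 : (0 < m)%N by rewrite mE !muln_gt0 d0 n0 T0.
(* Only grid points in the closed ball are kept, since the exponential moment bound holds there. *)
pose net := [pred f : {ffun 'I_n * bool -> 'I_(m.*2.+1)} |
  \sum_i normc (net_point (R := R) f 0 i) ^+ 2 <= 1].
pose L : R := (m.*2.+1 ^ (n * 2))%:R.
have netL : #|net|%:R <= L.
  by rewrite ler_nat (leq_trans (max_card _))// card_ffun card_ord card_prod card_ord card_bool.
have [eps epsP] : exists eps, \sum_(f in net) expR (normc (flat_poly eps (net_point f)) / 4)
    <= L * (4 * expR 1).
  apply: contrapT => h.
  have : \sum_(eps : {ffun word -> bool}) \sum_(f in net)
      expR (normc (flat_poly eps (net_point f)) / 4)
    <= #|{ffun word -> bool}|%:R * (L * (4 * expR 1)).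
    rewrite exchange_big/=.
    apply: (@le_trans _ _ (\sum_(f in net) #|{ffun word -> bool}|%:R * (4 * expR 1))).
      by apply: ler_sum => f fnet; exact: sum_expR_flat_poly.
    rewrite sumr_const -[leLHS]mulr_natl mulrCA ler_wpM2l//.
    by apply: ler_wpM2r; [rewrite mulr_ge0// expR_ge0 | exact: netL].
  apply/negP; rewrite -ltNge mulr_natl -sumr_const; apply: ltr_sum.
    by apply/hasP; exists [ffun=> true]; rewrite ?mem_index_enum.
  by move=> eps _; rewrite ltNge; apply/negP => le; apply: h; exists eps.
exists eps => z zb.
have z1 : \sum_i normc (z 0 i) ^+ 2 <= 1.
  by move: zb; rewrite /uball /= dotmx_self ltcR => /ltW.
have [f [f1 fz]] := net_approx m0 z1.
apply: le_trans epsP; rewrite (bigD1 f)//= -[leLHS]addr0; apply: lerD; last first.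
  by apply: sumr_ge0 => g _; exact: expR_ge0.
rewrite ler_expR ler_pM2r ?invr_gt0// lerBlDr.
apply: (flat_poly_lipschitz _ TE T0 z1 f1 fz).
have d0' : d%:R != 0 :> R by rewrite pnatr_eq0 -lt0n.
have n0' : n%:R != 0 :> R by rewrite pnatr_eq0 -lt0n.
have T0' : T%:R != 0 :> R by rewrite pnatr_eq0 -lt0n.
rewrite mE !natrM le_eqVlt; apply/orP; left; apply/eqP; field.
by rewrite d0' n0' T0'.
Qed.

End FlatPolynomials.

(** * Failure of contractivity *)

Section Asymptotics.
Context {R : realType}.

Lemma bernoulli_ge0 (x : R) k : 0 <= x -> 1 + k%:R * x <= (1 + x) ^+ k.
Proof.
move=> x0; elim: k => [|k IH]; first by rewrite mul0r addr0 expr0.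
rewrite exprS; have x1 : 0 <= 1 + x by rewrite addr_ge0.
apply: le_trans (ler_wpM2l x1 IH); rewrite -natr1 -subr_ge0.
have -> : (1 + x) * (1 + k%:R * x) - (1 + (k%:R + 1) * x) = k%:R * x ^+ 2 by ring.
by rewrite mulr_ge0// sqr_ge0.
Qed.

Lemma binomial_rising n d : (0 < n)%N ->
  'C(d + n.-1, d)%:R * d`!%:R = \prod_(j < d) (n%:R + j%:R) :> R.
Proof.
case: n => // n _ /=; elim: d => [|d IH].
  by rewrite bin0 fact0 mul1r big_ord0.
have e : d.+1%:R * 'C(d.+1 + n, d.+1)%:R = (n.+1%:R + d%:R) * 'C(d + n, d)%:R :> R.
  by rewrite -natrD -!natrM addSn -mul_bin_diag /= addSn addnC.
by rewrite big_ord_recr/= -IH factS natrM mulrA [_ * d.+1%:R]mulrC e; ring.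
Qed.

(** Raising [D] by one multiplies the product, after telescoping, by
    [(n + D + d) / (n + D) >= d / (n + D)]. *)
Lemma rising_ratio_ge (n D d : nat) : (0 < n)%N ->
  d%:R ^+ D / \prod_(i < D) (n%:R + i%:R) <=
  \prod_(j < d) ((n%:R + D%:R + j%:R) / (n%:R + j%:R)) :> R.
Proof.
move=> n0; have np i : 0 < n%:R + i%:R :> R by rewrite ltr_wpDr// ltr0n.
elim: D => [|D IH].
  rewrite big_ord0 expr0 divr1 big1// => j _.
  by rewrite addr0 divff// gt_eqF.
have step : \prod_(j < d) ((n%:R + D.+1%:R + j%:R) / (n%:R + j%:R)) =
    (n%:R + D%:R + d%:R) / (n%:R + D%:R) *
    \prod_(j < d) ((n%:R + D%:R + j%:R) / (n%:R + j%:R)) :> R.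
  elim: d {IH} => [|d IHd].
    by rewrite !big_ord0 addr0 divff ?mulr1// gt_eqF.
  rewrite !big_ord_recr/= IHd -!natr1 !addrA.
  have h1 : n%:R + D%:R + d%:R != 0 :> R by rewrite gt_eqF// ltr_wpDr.
  have h2 : n%:R + D%:R != 0 :> R by rewrite gt_eqF.
  have h3 : n%:R + d%:R != 0 :> R by rewrite gt_eqF.
  by move: (\prod_(_ < _) _) => P; field; rewrite h2 h3.
have h2 : 0 < n%:R + D%:R :> R by [].
have P0 : 0 < \prod_(i < D) (n%:R + i%:R) :> R by apply: prodr_gt0.
rewrite step big_ord_recr/= exprS.
have -> : d%:R * d%:R ^+ D / (\prod_(i < D) (n%:R + i%:R) * (n%:R + D%:R)) =
   d%:R / (n%:R + D%:R) * (d%:R ^+ D / \prod_(i < D) (n%:R + i%:R)) :> R.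
  by field; rewrite !gt_eqF.
apply: ler_pM => //; rewrite ?divr_ge0 ?exprn_ge0 ?(ltW P0) ?(ltW h2)//.
by rewrite ler_pM2r ?invr_gt0// lerDr ltW.
Qed.

Lemma expr_le_fact_expR (x : R) m : 0 <= x -> x ^+ m <= m`!%:R * expR x.
Proof.
move=> x0; case: m => [|m]; first by rewrite expr0 fact0 mul1r -expR0 ler_expR.
have f0 : 0 < m.+1`!%:R :> R by rewrite ltr0n fact_gt0.
rewrite mulrC -ler_pdivrMr//; apply: le_trans (expR_ge1Dxn m x0).
by rewrite lerDr.
Qed.

(* [V = T / pow_coef a d] grows like [d ^ (n - a)]; taking a power [k] with
   [k (n - a) >= D] turns this into an integral rate. *)
Lemma growth_lower_bound (n d D k : nat) (a : R) : (0 < n)%N -> 0 < a -> a <= n%:R ->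
  D%:R <= k%:R * (n%:R - a) ->
  exists2 V : R, 0 <= V /\ 'C(d + n.-1, d)%:R = pow_coef a d * V &
    d%:R ^+ D / \prod_(i < D) (n%:R + i%:R) <= V ^+ k.
Proof.
move=> n0 a0 an kD; have aj (j : nat) : 0 < a + j%:R by rewrite ltr_wpDr.
have nj (j : nat) : 0 < n%:R + j%:R :> R by rewrite ltr_wpDr// ltr0n.
have f0 : d`!%:R != 0 :> R by rewrite pnatr_eq0 -lt0n fact_gt0.
exists (\prod_(j < d) ((n%:R + j%:R) / (a + j%:R))).
  split; first by apply: prodr_ge0 => j _; rewrite divr_ge0// ltW.
  rewrite /pow_coef prodf_div -binomial_rising//.
  have P0 : \prod_(j < d) (a + j%:R) != 0 by rewrite gt_eqF// prodr_gt0.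
  by field; rewrite f0 P0.
apply: (le_trans (rising_ratio_ge D d n0)); rewrite -prodrXl.
apply: ler_prod => j _; apply/andP; split.
  by rewrite divr_ge0 ?(ltW (nj _))// addr_ge0 ?(ltW (nj _))// addr_ge0.
(* Factor by factor, Bernoulli gives [(1 + (n - a) / (a + j)) ^ k >= 1 + k (n - a) / (a + j) >= 1 +
   D / (n + j)]. *)
have -> : (n%:R + j%:R) / (a + j%:R) = 1 + (n%:R - a) / (a + j%:R).
  by field; rewrite gt_eqF.
have na : 0 <= n%:R - a by rewrite subr_ge0.
apply: le_trans (bernoulli_ge0 _ _); last by rewrite divr_ge0// ltW.
have -> : (n%:R + D%:R + j%:R) / (n%:R + j%:R) = 1 + D%:R / (n%:R + j%:R) :> R.
  by field; rewrite gt_eqF.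
rewrite lerD2l mulrA; apply: ler_pM; rewrite ?invr_ge0 ?(ltW (nj _))//.
by rewrite lef_pV2 ?posrE// lerD2r.
Qed.

Lemma ffact_le_expn (m i : nat) : (m ^_ i <= m ^ i)%N.
Proof.
elim: i => [|i IH]; first by rewrite ffactn0.
by rewrite ffactnSr expnSr leq_mul// leq_subr.
Qed.

(** For fixed [n] the net is polynomial in [d], because [T <= ((n + 1) d) ^ n]. The constant [9]
    comes from [2 m + 1 = 8 d n T^2 + 1]. *)
Lemma net_card_le (n d T : nat) : (0 < n)%N -> (0 < d)%N -> T = 'C(d + n.-1, d) ->
  (((4 * d * n * T ^ 2).*2.+1 ^ (n * 2)) <=
   (9 * n * n.+1 ^ (n * 2)) ^ (n * 2) * d ^ ((n * 2).+1 * (n * 2)))%N.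
Proof.
move=> n0 d0 TE.
have Tle : (T <= (n.+1 * d) ^ n)%N.
  rewrite TE -bin_sub ?leq_addr// addKn.
  apply: (@leq_trans ((d + n.-1) ^ n.-1)).
    have := bin_ffact (d + n.-1) n.-1 => h.
    apply: (@leq_trans ((d + n.-1) ^_ n.-1)); first by rewrite -h leq_pmulr// fact_gt0.
    exact: ffact_le_expn.
  apply: (@leq_trans ((n.+1 * d) ^ n.-1)).
    have hb : (d + n.-1 <= n.+1 * d)%N by nia.
    by case: (n.-1) hb => // i hb; rewrite leq_exp2r.
  by rewrite leq_pexp2l ?leq_pred// muln_gt0.
rewrite [(d ^ _)%N]expnM -expnMn leq_exp2r ?muln_gt0 ?n0//.
have T2 : (T ^ 2 <= n.+1 ^ (n * 2) * d ^ (n * 2))%N.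
  by rewrite -expnMn expnM leq_exp2r.
rewrite [(d ^ _.+1)%N]expnS.
move: T2; move: (T ^ 2)%N (n.+1 ^ _)%N (d ^ _)%N (expn_gt0 n.+1 (n * 2)) (expn_gt0 d (n * 2)).
rewrite d0 /= => t p q p0 q0 tpq.
have : (d * n * t <= d * n * (p * q))%N by rewrite leq_mul2l tpq orbT.
have : (0 < d * n * (p * q))%N by rewrite !muln_gt0 d0 n0 p0 q0.
have -> : (9 * n * p * (d * q) = 9 * (d * n * (p * q)))%N by ring.
lia.
Qed.

End Asymptotics.

Section NotContractive.
Context {R : realType} {n : nat} (a : R).
Notation C := R[i].
Context (H : completeNormedModType C) (dot : {dot H for Num.conj})
  (ev : H -> 'rV[C]_n -> C).
Hypothesis n0 : (0 < n)%N.
Hypothesis a0 : 0 < a.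
Hypothesis rkhs :
  is_holomorphic_rkhs dot (fun z w => cpow (1 - dotmx z w) (- a)) ev.
Hypothesis contr : mult_contractive ev.

Let A := ((n * 2).+1 * (n * 2))%N.
Let q := ((9 * n * n.+1 ^ (n * 2)) ^ (n * 2))%N.

(** A flat polynomial bounded by [B = 1 + 4 ln Phi] forces [V <= B ^ 2]. Then
    [V ^ k <= B ^ (2 k) <= (2 k)! expR B], and [expR B = expR 1 * Phi ^ 4] is polynomial in [d]. The
    point is that the exponent [A * 4] does not depend on [k]. *)
Lemma contractive_growth_le (d k : nat) (V : R) : (0 < d)%N ->
  0 <= V -> 'C(d + n.-1, d)%:R = pow_coef a d * V ->
  V ^+ k <= (2 * k)`!%:R * expR 1 * (q%:R * (4 * expR 1)) ^+ 4 * d%:R ^+ (A * 4).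
Proof.
move=> d0 V0; set T := 'C(d + n.-1, d) => TV.
have T0 : (0 < T)%N by rewrite bin_gt0 leq_addr.
have cardT : T = #|[set t : d.-tuple 'I_n | sorted_word t]| by rewrite card_sorted_words.
have [eps epsP] := @exists_flat_poly R n d T _ cardT T0 d0 n0 erefl.
set m := (4 * d * n * T ^ 2)%N in epsP.
set Phi := _ * (4 * expR 1) in epsP.
have e1 : 0 < 4 * expR 1 :> R by rewrite mulr_gt0// expR_gt0.
have Phi0 : 0 < Phi by rewrite mulr_gt0// ltr0n expn_gt0.
pose B := 1 + 4 * ln Phi.
have pB z : uball z -> normc (flat_poly eps z) <= B.
  by move=> /epsP; rewrite -[leRHS]lnK ?posrE// ler_expR /B; lra.
have B0 : 0 <= B.
  have ball0 : uball (0 : 'rV[C]_n) by rewrite /uball /= linear0l.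
  by apply: le_trans (pB 0 ball0); exact: normc_ge0.
have K1 (z : 'rV[C]_n) : uball z -> cpow (1 - dotmx z 0) (- a) = 1.
  by move=> _; rewrite linear0r subr0 cpow1.
have hp : holomorphic_near_closed_ball (@flat_poly R n d eps).
  exact: holomorphic_word_poly.
have [h evh hB] := contractive_bound rkhs K1 contr hp pB.
have := rkhs_norm_lower_bound (ltW a0) rkhs evh.
rewrite weighted_norm2_flat -cardT TV => VB.
have c0 : 0 < pow_coef a d.
  by rewrite divr_gt0 ?ltr0n ?fact_gt0// prodr_gt0// => i _; rewrite ltr_wpDr.
have {}VB : V <= B ^+ 2 by apply: le_trans hB; rewrite -(ler_pM2l c0).
apply: (@le_trans _ _ (B ^+ (2 * k))).
  by rewrite exprM lerXn2r// nnegrE ?exprn_ge0.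
apply: (le_trans (expr_le_fact_expR _ B0)); rewrite -[leRHS]mulrA -[leRHS]mulrA ler_wpM2l//.
rewrite expRD ler_wpM2l ?expR_ge0// expRM_natl lnK ?posrE//.
rewrite exprM -exprMn lerXn2r ?nnegrE ?(ltW Phi0)//.
rewrite /Phi [leRHS]mulrAC ler_wpM2r ?(ltW e1)// -natrX -natrM ler_nat.
exact: net_card_le.
Qed.

End NotContractive.

Lemma not_mult_contractive (R : realType) (n : nat) (a : R)
    (H : completeNormedModType R[i]) (dot : {dot H for Num.conj})
    (ev : H -> 'rV[R[i]]_n -> R[i]) : (0 < n)%N -> 0 < a -> a < n%:R ->
  is_holomorphic_rkhs dot (fun z w => cpow (1 - dotmx z w) (- a)) ev ->
  ~ mult_contractive ev.
Proof.
move=> n0 a0 an rkhs contr.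
pose A := ((n * 2).+1 * (n * 2) * 4)%N.
have na : 0 < n%:R - a by rewrite subr_gt0.
(* With this [k], [V ^ k] grows at least like [d ^ (A + 1)], one degree above the bound from
   contractivity, so every [d] would be at most the constant [K]. *)
pose k := (Num.truncn (A.+1%:R / (n%:R - a))).+1.
have kD : A.+1%:R <= k%:R * (n%:R - a).
  by rewrite -ler_pdivrMr// ltW// truncnS_gt.
set q := ((9 * n * n.+1 ^ (n * 2)) ^ (n * 2))%N.
pose c : R := \prod_(i < A.+1) (n%:R + i%:R).
have c0 : 0 < c by apply: prodr_gt0 => i _; rewrite ltr_wpDr// ltr0n.
pose K := (2 * k)`!%:R * expR 1 * (q%:R * (4 * expR 1)) ^+ 4 * c.
have dK d : (0 < d)%N -> d%:R <= K.
  move=> d0; have dR : 0 < d%:R :> R by rewrite ltr0n.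
  have [V [V0 TV]] := growth_lower_bound d n0 a0 (ltW an) kD.
  move=> /le_trans/(_ (contractive_growth_le n0 a0 rkhs contr k d0 V0 TV)).
  rewrite ler_pdivrMr// exprS -/A mulrAC ler_pM2r ?exprn_gt0//.
have := dK (Num.truncn K).+1 isT; apply/negP; rewrite -ltNge.
by rewrite truncnS_gt.
Qed.

(** * Curvature *)

Section Curvature.
Context {R : realType} {n : nat}.
Notation C := R[i].
Implicit Types z w v : 'rV[C]_n.

Definition defect z : R := 1 - complex.Re (dotmx z z).

Lemma dotmx_selfE z : dotmx z z = (complex.Re (dotmx z z))%:C%C.
Proof. by apply: ge0_ReE; exact: dnorm_ge0. Qed.

Lemma uball_defect z : uball z <-> 0 < defect z.
Proof. by rewrite /uball /= dotmx_selfE ltcR /defect subr_gt0. Qed.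

Lemma defect_line z v (t : R) : defect (z + t%:C%C *: v) =
  defect z - t * (2 * complex.Re (dotmx z v)) - t ^+ 2 * complex.Re (dotmx v v).
Proof.
rewrite /defect dnormD dnormZ linearZr_LR /= conj_real normr_normc normcR.
rewrite -rmorphXn /= real_normK ?num_real//.
case: (dotmx z v) => x y; case: (dotmx z z) => p q; case: (dotmx v v) => p' q' /=; ring.
Qed.

Lemma is_derive_defect z v : is_derive (0 : R) 1 (fun t : R => defect (z + t%:C%C *: v))
  (- (2 * complex.Re (dotmx z v))).
Proof.
have quad (p q r : R) : is_derive (0 : R) 1 (fun t : R => p - t * q - t ^+ 2 * r) (- q).
  by apply: is_derive_eq; rewrite /GRing.scale/=; ring.
by under eq_fun do rewrite defect_line; exact: quad.
Qed.

Lemma near_line_uball z v : uball z -> \forall t \near (0 : R), uball (z + t%:C%C *: v).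
Proof.
move=> /uball_defect z0.
have : {for (0 : R), continuous (fun t : R => defect (z + t%:C%C *: v))}.
  apply/differentiable_continuous/derivable1_diffP.
  by have := is_derive_defect z v; move=> h; exact: ex_derive.
move=> /cvgr_gt /= /(_ 0); rewrite scale0r addr0 => /(_ z0).
by apply: filterS => t ?; apply/uball_defect.
Qed.

(** The formulas for [log K] and its first derivatives are established only on the ball; this lets
    them be substituted under a further derivative. *)
Lemma real_derive_near (g g' : 'rV[C]_n -> C) v z :
  uball z -> (forall z, uball z -> g z = g' z) ->
  real_derive v g z = real_derive v g' z.
Proof.
move=> zb gg; rewrite /real_derive !derive1E.
have near_z := near_line_uball v zb.
have -> : 'D_1 (fun t : R => complex.Re (g (z + t%:C%C *: v))) 0 =
    'D_1 (fun t : R => complex.Re (g' (z + t%:C%C *: v))) 0.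
  by apply: near_eq_derive; apply: filterS near_z => t /gg ->.
have -> : 'D_1 (fun t : R => complex.Im (g (z + t%:C%C *: v))) 0 =
    'D_1 (fun t : R => complex.Im (g' (z + t%:C%C *: v))) 0.
  by apply: near_eq_derive; apply: filterS near_z => t /gg ->.
by [].
Qed.

Lemma real_derive_ln_defect (b : R) v z : uball z ->
  real_derive v (fun z => (- b * ln (defect z))%:C%C) z =
  (b * (2 * complex.Re (dotmx z v)) / defect z)%:C%C.
Proof.
move=> /uball_defect z0; rewrite /real_derive /= !derive1E derive_cst.
have d0 := is_derive_defect z v.
have z0' : 0 < defect (z + (0 : R)%:C%C *: v) by rewrite scale0r addr0.
have h : is_derive (0 : R) 1 (fun t : R => ln (defect (z + t%:C%C *: v))) _ :=
  @is_derive1_comp _ (@ln R) (fun t : R => defect (z + t%:C%C *: v)) _ _ _ (is_derive1_ln z0') d0.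
have h2 := is_deriveZ (- b) h.
rewrite (@derive_val _ _ _ _ _ _ _ h2) scale0r addr0 /GRing.scale /=.
have field_id (r p : R) : 0 < r -> - b * (r^-1 * - (2 * p)) = b * (2 * p) / r.
  by move=> r0; field; rewrite gt_eqF.
by rewrite field_id.
Qed.

Lemma real_derive_coord_div_defect (b : R) v z j : uball z ->
  real_derive v (fun z => (b / defect z)%:C%C * z 0 j) z =
  b%:C%C * (v 0 j / (defect z)%:C%C
    + (2 * complex.Re (dotmx z v))%:C%C * z 0 j / (defect z)%:C%C ^+ 2).
Proof.
move=> /uball_defect z0.
have ReC (x : R) (u : C) : complex.Re (x%:C%C * u) = x * complex.Re u.
  by case: u => p q; rewrite /= mul0r subr0.
have ImC (x : R) (u : C) : complex.Im (x%:C%C * u) = x * complex.Im u.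
  by case: u => p q; rewrite /= mul0r addr0.
have d0 := is_derive_defect z v.
have zn : defect (z + (0 : R)%:C%C *: v) != 0 by rewrite scale0r addr0 gt_eqF.
have hV := @is_deriveV _ (fun t : R => defect (z + t%:C%C *: v)) 0 _ 1 zn d0.
have key (p q : R) : 'D_1 (fun t : R => b / defect (z + t%:C%C *: v) * (p + t * q)) 0 =
   b * (q / defect z + 2 * complex.Re (dotmx z v) * p / defect z ^+ 2).
  have hl : is_derive (0 : R) 1 (fun t : R => p + t * q) q.
    by apply: is_derive_eq; rewrite /GRing.scale/=; ring.
  have h := is_deriveM (is_deriveZ b hV) hl.
  rewrite (@derive_val _ _ _ _ _ _ _ h) /= scale0r addr0 mul0r addr0 /GRing.scale /=.
  by field; rewrite gt_eqF.
rewrite /real_derive !derive1E.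
have -> : (fun t : R => complex.Re ((b / defect (z + t%:C%C *: v))%:C%C * (z + t%:C%C *: v) 0 j))
    = (fun t : R => b / defect (z + t%:C%C *: v) * (complex.Re (z 0 j) + t * complex.Re (v 0 j))).
  by apply/funext => t; rewrite ReC !mxE raddfD /= ReC.
rewrite key.
have -> : (fun t : R => complex.Im ((b / defect (z + t%:C%C *: v))%:C%C * (z + t%:C%C *: v) 0 j))
    = (fun t : R => b / defect (z + t%:C%C *: v) * (complex.Im (z 0 j) + t * complex.Im (v 0 j))).
  by apply/funext => t; rewrite ImC !mxE raddfD /= ImC.
rewrite key.
have zn' : defect z != 0 by rewrite gt_eqF.
move: (z 0 j) (v 0 j) => [x y] [x' y'] /=.
by apply/eqP; rewrite eq_complex /=; apply/andP; split; apply/eqP; field.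
Qed.

Lemma Re_dot_delta z j : complex.Re (dotmx z (delta_mx 0 j)) = complex.Re (z 0 j).
Proof.
rewrite dotmx_sum (bigD1 j)//= mxE !eqxx rmorph1 mulr1 big1 ?addr0// => i ij.
by rewrite mxE eqxx (negPf ij) rmorph0 mulr0.
Qed.

Lemma Re_dot_idelta z j :
  complex.Re (dotmx z ('i%C *: delta_mx 0 j)) = complex.Im (z 0 j).
Proof.
rewrite linearZr_LR /= dotmx_sum (bigD1 j)//= mxE !eqxx rmorph1 mulr1 big1 ?addr0.
  by case: (z 0 j) => x y /=; ring.
by move=> i ij; rewrite mxE eqxx (negPf ij) rmorph0 mulr0.
Qed.

(** With [r = 1 - |z|^2], the derivative of [- b ln r] in the conjugate of [z_j] is [b z_j / r];
    differentiating in [z_i] gives [b (delta_ij / r + conj(z_i) z_j / r^2)]. *)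
Lemma curvature_power (K : 'rV[C]_n -> 'rV[C]_n -> C) (b : R) w :
  (forall z, uball z -> ln (complex.Re (K z z)) = - b * ln (defect z)) ->
  uball w ->
  curvature K w = - b%:C%C *: ((defect w)%:C%C^-1 *: 1%:M
     + (defect w)%:C%C ^- 2 *: (w ^t* *m w)).
Proof.
move=> KE wb.
have dzbarE j z : uball z ->
    dzbar j (fun z => (ln (complex.Re (K z z)))%:C%C) z = (b / defect z)%:C%C * z 0 j.
  move=> zb; rewrite /dzbar.
  have E v := @real_derive_near _ (fun z => (- b * ln (defect z))%:C%C) v z zb
     (fun z zb => congr1 _ (KE z zb)).
  rewrite !E !real_derive_ln_defect// Re_dot_delta Re_dot_idelta.
  have /uball_defect/gt_eqF/negbT zn := zb.
  case: (z 0 j) => x y /=.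
  by apply/eqP; rewrite eq_complex /=; apply/andP; split; apply/eqP; field.
rewrite /curvature; apply/matrixP => i j; rewrite !mxE.
have E v := @real_derive_near _ (fun z => (b / defect z)%:C%C * z 0 j) v w wb (dzbarE j).
rewrite /dz !E !real_derive_coord_div_defect// Re_dot_delta Re_dot_idelta.
have /uball_defect/gt_eqF/negbT wn := wb.
rewrite !mxE big_ord1 !mxE eqxx /= eq_sym.
have -> : ord0 = 0 :> 'I_1 by apply: val_inj.
move: (defect w) wn => r rn; move: (w 0 i) (w 0 j) => [x y] [x' y'].
by case: (i == j); apply/eqP; rewrite eq_complex /=; apply/andP; split; apply/eqP; field.
Qed.

(** The difference of the curvatures is [(b - b') G], where the form of [G] at [v] is
    [|v|^2 / r + |<v, w>|^2 / r^2] with [r = defect w > 0]. *)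
Lemma herm_le_curvature (K L : 'rV[C]_n -> 'rV[C]_n -> C) (b b' : R) w :
  (forall z, uball z -> ln (complex.Re (K z z)) = - b * ln (defect z)) ->
  (forall z, uball z -> ln (complex.Re (L z z)) = - b' * ln (defect z)) ->
  b' <= b -> uball w -> herm_le (curvature K w) (curvature L w).
Proof.
move=> KE LE bb wb; rewrite (curvature_power KE wb) (curvature_power LE wb).
have r0 : 0 < defect w by apply/uball_defect.
have rr : 0 <= (defect w)%:C%C^-1 :> C by rewrite invr_ge0 lecR ltW.
set G := (_ *: 1%:M + _).
have GE i j : G i j = (defect w)%:C%C^-1 * (i == j)%:R + (defect w)%:C%C ^- 2 * ((w 0 i)^* * w 0 j).
  by rewrite !mxE big_ord1 !mxE.
have gh i j : (G j i)^* = G i j.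
  rewrite !GE rmorphD !rmorphM /= rmorph_nat eq_sym !fmorphV rmorphXn /= conj_real.
  by rewrite conjCK; ring.
have hG (c : R) : c%:C%C *: G \is hermsymmx.
  move: (G) gh => M gh; apply/is_hermitianmxP/matrixP => i j.
  by rewrite expr0 scale1r !mxE rmorphM /= conj_real gh.
split; rewrite -?rmorphN; [exact: hG|exact: hG|].
move=> v; rewrite -scalerBl -rmorphB.
have -> : - b' - - b = b - b' by ring.
rewrite -scalemxAr -scalemxAl mxE mulr_ge0// ?lecR ?subr_ge0//.
rewrite /G mulmxDr mulmxDl -!scalemxAr -!scalemxAl mulmx1 mxE addr_ge0//.
  by rewrite mxE -dotmxE mulr_ge0// dnorm_ge0.
rewrite mxE mulr_ge0//; first by rewrite -exprVn exprn_ge0.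
rewrite mulmxA -[_ *m w *m _]mulmxA mxE big_ord1 -!dotmxE.
by rewrite (hermC _ w v) expr0 mul1r -normCK exprn_ge0.
Qed.

Lemma ln_bergman_pow_diag (lambda : R) z : uball z ->
  ln (complex.Re (bergman_pow lambda z z)) = - (lambda * n.+1%:R) * ln (defect z).
Proof.
move=> /uball_defect z0; rewrite /bergman_pow /cpow.
have -> : 1 - dotmx z z = (defect z)%:C%C by rewrite dotmx_selfE /defect rmorphB.
rewrite normcR gtr0_norm//= mul0r atan0 mulr0 cos0 sin0 mulr1 mulr0 subr0.
by rewrite ln_powR.
Qed.

Lemma ln_drury_arveson_diag z : uball z ->
  ln (complex.Re (drury_arveson z z)) = - 1 * ln (defect z).
Proof.
move=> /uball_defect z0; rewrite /drury_arveson.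
have -> : 1 - dotmx z z = (defect z)%:C%C by rewrite dotmx_selfE /defect rmorphB.
by rewrite -(fmorphV (real_complex R)) /= lnV// mulN1r.
Qed.

End Curvature.

Unset Implicit Arguments.

Theorem mainTheorem4 (R : realType) (n : nat) (lambda : R)
  (n_gt1 : (1 < n)%N)
  (lambda_ge : (n.+1%:R)^-1 <= lambda)
  (lambda_lt : lambda < n%:R / n.+1%:R)
  (H : completeNormedModType R[i]) (dot : {dot H for Num.conj})
  (ev : H -> 'rV[R[i]]_n -> R[i])
  (H_rkhs : is_holomorphic_rkhs dot (@bergman_pow R n lambda) ev) :
  (forall w, uball w ->
     herm_le (curvature (@bergman_pow R n lambda) w)
             (curvature (@drury_arveson R n) w)) /\
  ~ mult_contractive ev.
Proof.
have n1 : 0 < n.+1%:R :> R by rewrite ltr0n.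
(* In terms of [a = lambda * (n + 1)], the bound [1 <= a] gives the curvature inequality and [a < n]
   the failure of contractivity. *)
have a_ge1 : 1 <= lambda * n.+1%:R by rewrite -ler_pdivrMr// div1r.
split.
  move=> w wb; apply: (herm_le_curvature (ln_bergman_pow_diag lambda) _ a_ge1 wb).
  exact: ln_drury_arveson_diag.
apply: (@not_mult_contractive R n (lambda * n.+1%:R) H dot ev) => //.
- exact: ltnW.
- exact: lt_le_trans a_ge1.
- by rewrite -ltr_pdivlMr.
Qed.
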